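(* Let $X$ be a compact metric space with metric $d$, let $T:X\to X$ be continuous, and let $\mathcal{F}=\{f_n\}_{n\ge1}$ be a subadditive potential on $X$. Then for every ergodic $T$-invariant Borel probability measure $\mu$ with $\mathcal{F}_*(\mu)\neq-\infty$, \[ P^*_\mu(T,\mathcal{F})=\underline{CP}^*_\mu(T,\mathcal{F})=\overline{CP}^*_\mu(T,\mathcal{F})=P_\mu(T,\mathcal{F})=h_\mu(T)+\mathcal{F}_*(\mu). \]
   Context: $h_\mu(T)$ is the measure-theoretic (Kolmogorov–Sinai) entropy. For $x,y\in X$ and $n\ge1$ let $d_n(x,y)=\max\{d(T^ix,T^iy):0\le i\le n-1\}$ and $B_n(x,\epsilon)=\{y\in X:d_n(x,y)<\epsilon\}$ (Bowen ball). A subadditive potential is a sequence $\{f_n\}_{n\ge1}$ of continuous real functions on $X$ with $f_{n+m}(x)\le f_n(x)+f_m(T^nx)$ for all $x\in X$, $n,m\ge1$. For an invariant measure $\mu$, $\mathcal{F}_*(\mu)=\lim_{n\to\infty}\frac1n\int f_n\,d\mu=\inf_{n\ge1}\frac1n\int f_n\,d\mu$. Spanning pressure: for $0<\delta<1$, $n\ge1$, $\epsilon>0$, a set $F\subseteq X$ is $(n,\epsilon,\delta)$-spanning if $\mu\big(\bigcup_{x\in F}B_n(x,\epsilon)\big)\ge1-\delta$. Put $P_\mu(T,\mathcal{F},n,\epsilon,\delta)=\inf\{\sum_{x\in F}\exp(\sup_{y\in B_n(x,\epsilon)}f_n(y)): F \text{ is } (n,\epsilon,\delta)\text{-spanning}\}$,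 $P_\mu(T,\mathcal{F},\epsilon,\delta)=\limsup_{n\to\infty}\frac1n\log P_\mu(T,\mathcal{F},n,\epsilon,\delta)$, $P_\mu(T,\mathcal{F},\delta)=\liminf_{\epsilon\to0}P_\mu(T,\mathcal{F},\epsilon,\delta)$, and $P_\mu(T,\mathcal{F})=\lim_{\delta\to0}P_\mu(T,\mathcal{F},\delta)$ (the limit exists by monotonicity in $\delta$). Carathéodory pressure: for $Z\subseteq X$ and $\epsilon>0$, a cover of $Z$ is a countable family $\Gamma=\{B_{n_i}(x_i,\epsilon)\}_i$ with $Z\subseteq\bigcup_iB_{n_i}(x_i,\epsilon)$; set $n(\Gamma)=\min_in_i$. For $s\ge0$, $M(Z,\mathcal{F},s,N,\epsilon)=\inf_\Gamma\sum_i\exp\big(-sn_i+\sup_{y\in B_{n_i}(x_i,\epsilon)}f_{n_i}(y)\big)$, infimum over covers $\Gamma$ of $Z$ with $n(\Gamma)\ge N$; $m(Z,\mathcal{F},s,\epsilon)=\lim_{N\to\infty}M(Z,\mathcal{F},s,N,\epsilon)$; $P_Z(T,\mathcal{F},\epsilon)=\inf\{s:m(Z,\mathcal{F},s,\epsilon)=0\}=\sup\{s:m(Z,\mathcal{F},s,\epsilon)=+\infty\}$; $P_Z(T,\mathcal{F})=\liminf_{\epsilon\to0}P_Z(T,\mathcal{F},\epsilon)$. Then $P^*_\mu(T,\mathcal{F},\epsilon)=\inf\{P_Z(T,\mathcal{F},\epsilon):\mu(Z)=1\}$ and $P^*_\mu(T,\mathcal{F})=\liminf_{\epsilon\to0}P^*_\mu(T,\mathcal{F},\epsilon)$.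 Capacity pressures: $\Lambda(Z,\mathcal{F},N,\epsilon)=\inf\sum_i\exp(\sup_{y\in B_N(x_i,\epsilon)}f_N(y))$, infimum over covers $\{B_N(x_i,\epsilon)\}_i$ of $Z$ (all $n_i=N$); $\underline{CP}_Z(T,\mathcal{F},\epsilon)=\liminf_{N\to\infty}\frac1N\log\Lambda(Z,\mathcal{F},N,\epsilon)$ and $\overline{CP}_Z(T,\mathcal{F},\epsilon)=\limsup_{N\to\infty}\frac1N\log\Lambda(Z,\mathcal{F},N,\epsilon)$. Then $\underline{CP}^*_\mu(T,\mathcal{F},\epsilon)=\lim_{\delta\to0}\inf\{\underline{CP}_Z(T,\mathcal{F},\epsilon):\mu(Z)\ge1-\delta\}$, $\overline{CP}^*_\mu(T,\mathcal{F},\epsilon)=\lim_{\delta\to0}\inf\{\overline{CP}_Z(T,\mathcal{F},\epsilon):\mu(Z)\ge1-\delta\}$, $\underline{CP}^*_\mu(T,\mathcal{F})=\liminf_{\epsilon\to0}\underline{CP}^*_\mu(T,\mathcal{F},\epsilon)$, $\overline{CP}^*_\mu(T,\mathcal{F})=\liminf_{\epsilon\to0}\overline{CP}^*_\mu(T,\mathcal{F},\epsilon)$.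
   Formalization: In the Carathéodory pressure the parameter s ranges over all real numbers instead of s ≥ 0, since with s ≥ 0 the equality fails whenever h_μ(T)+F_*(μ) is negative (e.g. a one-point space with f_n = −n). *)

(* Defs.v *)
From HB Require Import structures.
From mathcomp Require Import all_boot all_order all_algebra.
From mathcomp Require Import all_classical all_reals all_analysis.

Set Implicit Arguments.
Unset Strict Implicit.
Unset Printing Implicit Defensive.

Import Order.TTheory GRing.Theory Num.Theory.
Import numFieldNormedType.Exports.

Local Open Scope classical_set_scope.
Local Open Scope ring_scope.

(* Borel sigma-algebra of a metric space X (X given with a point x0,   *)
(* which MathComp's measurable types require to be pointed).           *)
Section Borel.
Context {R : realType} (X : metricType R) (x0 : X).

Definition ptdX (p : X) : Type := X.
HB.instance Definition _ := Choice.on (ptdX x0).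
HB.instance Definition _ := isPointed.Build (ptdX x0) x0.

Definition borelX := g_sigma_algebraType (@open X : set (set (ptdX x0))).
End Borel.

Section Defs.
Context {R : realType} {X : metricType R} {x0 : X}.
Local Notation BX := (@borelX R X x0).
Implicit Types (mu : probability BX R) (T : X -> X) (f : nat -> X -> R).

Definition bowen T (n : nat) (x : X) (eps : R) : set X :=
  [set y | forall i, (i < n)%N -> mdist (iter i T x) (iter i T y) < eps].

Definition supB T f (n : nat) (x : X) (eps : R) : R :=
  sup [set f n y | y in bowen T n x eps].

Definition phiE (t : R) : R := if t == 0 then 0 else - (t * ln t).

Definition fin_partition (m : nat) (P : 'I_m -> set X) : Prop :=
  (forall i, measurable (P i : set BX)) /\
  (forall i j, i != j -> P i `&` P j = set0) /\
  (forall x : X, exists i, P i x).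

Definition Hjoin mu T (m : nat) (P : 'I_m -> set X) (n : nat) : R :=
  \sum_(k : {ffun 'I_n -> 'I_m})
     phiE (fine (mu ([set y : X | forall i : 'I_n, P (k i) (iter i T y)]
                       : set BX))).

Definition hpart mu T (m : nat) (P : 'I_m -> set X) : R :=
  limn (fun n : nat => n%:R^-1 * Hjoin mu T P n).

Definition ks_entropy mu T : \bar R :=
  ereal_sup [set (hpart mu T (projT2 P))%:E
            | P in [set P : {m : nat & 'I_m -> set X} | fin_partition (projT2 P)]
            ].

Definition Fstar mu f : \bar R :=
  ereal_inf [set ((n%:R^-1)%:E * \int[mu]_(x in [set: BX]) (f n x)%:E)%E
            | n in [set n : nat | (0 < n)%N]].

Definition spanPn mu T f (n : nat) (eps delta : R) : \bar R :=
  ereal_inf [set (\esum_(x in F) (expR (supB T f n x eps))%:E)%E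
            | F in [set F : set X |
                ((1 - delta)%:E <= mu (\bigcup_(x in F) bowen T n x eps : set BX))%E]].

Definition spanP_eps mu T f (eps delta : R) : \bar R :=
  limn_esup (fun n : nat => ((n%:R^-1)%:E * lne (spanPn mu T f n eps delta))%E).

Definition spanP_delta mu T f (delta : R) : \bar R :=
  limf_einf (fun eps => spanP_eps mu T f eps delta) (0^'+).

Definition spanP mu T f : \bar R :=
  lim (spanP_delta mu T f x @[x --> 0^'+]).

(* M(Z, F, s, N, eps): covers are countable families {B_{n_i}(x_i,eps)}_{i in J} *)
Definition caraM T f (Z : set X) (s : R) (N : nat) (eps : R) : \bar R :=
  ereal_inf [set S | exists (J : set nat) (x : nat -> X) (n : nat -> nat),
     [/\ forall i, J i -> (N <= n i)%N,
         Z `<=` \bigcup_(i in J) bowen T (n i) (x i) eps &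
         S = (\esum_(i in J) (expR (- (s * (n i)%:R) + supB T f (n i) (x i) eps))%:E)%E]].

Definition caram T f (Z : set X) (s eps : R) : \bar R :=
  limn (fun N => caraM T f Z s N eps).

Definition caraPZ_eps T f (Z : set X) (eps : R) : \bar R :=
  ereal_inf [set s%:E | s in [set s : R | caram T f Z s eps = 0%E]].

Definition caraPZ T f (Z : set X) : \bar R :=
  limf_einf (caraPZ_eps T f Z) (0^'+).

Definition Pstar_eps mu T f (eps : R) : \bar R :=
  ereal_inf [set caraPZ_eps T f Z eps
            | Z in [set Z : set X | measurable (Z : set BX) /\ mu Z = 1%E]].

Definition Pstar mu T f : \bar R := limf_einf (Pstar_eps mu T f) (0^'+).

Definition Lambda T f (Z : set X) (N : nat) (eps : R) : \bar R :=
  ereal_inf [set S | exists (J : set nat) (x : nat -> X),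
     Z `<=` \bigcup_(i in J) bowen T N (x i) eps /\
     S = (\esum_(i in J) (expR (supB T f N (x i) eps))%:E)%E].

Definition lowCPZ T f (Z : set X) (eps : R) : \bar R :=
  limn_einf (fun N : nat => ((N%:R^-1)%:E * lne (Lambda T f Z N eps))%E).

Definition upCPZ T f (Z : set X) (eps : R) : \bar R :=
  limn_esup (fun N : nat => ((N%:R^-1)%:E * lne (Lambda T f Z N eps))%E).

Definition lowCPstar_eps mu T f (eps : R) : \bar R :=
  lim ((fun delta => ereal_inf [set lowCPZ T f Z eps
          | Z in [set Z : set X | measurable (Z : set BX) /\
                                  ((1 - delta)%:E <= mu Z)%E]]) x @[x --> 0^'+]).

Definition upCPstar_eps mu T f (eps : R) : \bar R :=
  lim ((fun delta => ereal_inf [set upCPZ T f Z eps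
          | Z in [set Z : set X | measurable (Z : set BX) /\
                                  ((1 - delta)%:E <= mu Z)%E]]) x @[x --> 0^'+]).

Definition lowCPstar mu T f : \bar R := limf_einf (lowCPstar_eps mu T f) (0^'+).
Definition upCPstar mu T f : \bar R := limf_einf (upCPstar_eps mu T f) (0^'+).

Definition subadditive_potential T f : Prop :=
  (forall n, (0 < n)%N -> continuous (f n)) /\
  (forall n m x, (0 < n)%N -> (0 < m)%N -> f (n + m)%N x <= f n x + f m (iter n T x)).

Definition invariant mu T : Prop :=
  forall A : set BX, measurable A -> mu (T @^-1` A : set BX) = mu A.

Definition ergodic mu T : Prop :=
  invariant mu T /\
  forall A : set BX, measurable A -> (T @^-1` A : set BX) = A -> mu A = 0%E \/ mu A = 1%E.

End Defs.

(* Main.v *)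
From HB Require Import structures.
From mathcomp Require Import all_boot all_order all_algebra.
From mathcomp Require Import all_classical all_reals all_analysis measurable_realfun.
From mathcomp Require Import ring lra zify finmap.
Require Import Defs.

(* Write V = h_mu(T) + F_*(mu).  No pointwise theorem is needed for the lower
   bounds.  Fix a finite partition P and a family of Bowen balls covering most of
   X.  A typical orbit of length n is cut greedily into passages through balls of
   the family and rare skipped steps; the resulting code determines the P-name up
   to a small Hamming distance and bounds f_n from above, while the weights of the
   codes satisfy a Kraft inequality.  Gibbs' inequality then bounds the entropy of
   the n-th refinement of P plus the mean of f_n by the exponent of the cover.
   For covers by balls of one common length the code is the centre of the ball.

   For the upper bounds, cut the P-name of x into blocks of length k.  Averaging
   over the k phases yields a code whose cost is at most the Birkhoff sum of
   -(1/k) log mu(P^k(x)), up to a constant; subadditivity bounds f_n in the same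
   way by the Birkhoff sum of f_j/j.  The sum of these two functions is bounded
   and has integral close to at most V, so by the maximal ergodic theorem its
   Birkhoff sums are at most n(V + eta) + C, for all n at once, on a set of measure
   close to 1, and this set is covered economically by Bowen balls. *)

Set Implicit Arguments.
Unset Strict Implicit.
Unset Printing Implicit Defensive.

Import Order.TTheory GRing.Theory Num.Theory.
Import numFieldNormedType.Exports.

Local Open Scope classical_set_scope.
Local Open Scope ring_scope.

(** * Entropy function, codes and subadditive averages *)

Section entropy_function.
Context {R : realType}.
Implicit Types p q v Z : R.

(** The order of choices differs on the two sides. In the lower bounds the partition comes first.
    Its boundary may carry mass, so nearby orbits need not have equal names; the parts of [P] are
    therefore separated on a set [G] of measure close to 1, and the radius is taken below half the
    separation. In the upper bounds the radius comes first and a partition of smaller diameter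
    second, so uniformity in the radius comes only from the supremum defining h_mu(T). Covers
    control only a set of measure [1 - t], whereas entropy and the mean of f_n are global averages.
    The exceptional set must cost at most a small multiple of n, uniformly in the cover; this uses
    linear a priori bounds, and F_*(mu) > -oo supplies the one from below. Suprema of f_n over Bowen
    balls are harmless in the lower bounds, where they only dominate f_n. In the upper bounds they
    are compared with Birkhoff sums of a single f_j, whose uniform continuity makes the distortion
    at most n eta. In both directions the alphabet has cheap long letters and single-step letters
    that make every orbit segment codable; each kind receives total weight at most 1/2. *)

Lemma phiEE p : phiE p = - (p * ln p).
Proof. by rewrite /phiE; case: eqVneq => // ->; rewrite mul0r oppr0. Qed.

(** This is [ln y <= y - 1] at [y = v / (Z * p)], multiplied by [p]. Summed over atoms with the [v]
    adding up to at most [Z] it is Gibbs' inequality; the term [v / Z - p] is kept because the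
    masses [p] may be those of a set that is not the whole space. *)
Lemma phiE_gibbs p v Z : 0 <= p -> 0 < v -> 0 < Z ->
  phiE p + p * ln v <= p * ln Z + v / Z - p.
Proof.
move=> p0 v0 Z0; rewrite phiEE; case: (eqVneq p 0) => [->|pn0].
  by rewrite !mul0r !oppr0 !addr0 add0r divr_ge0 ?ltW.
have pp : 0 < p by rewrite lt_neqAle eq_sym pn0.
have y0 : 0 < v / (Z * p) by rewrite divr_gt0 ?mulr_gt0.
have := le_ln1Dx (x := v / (Z * p) - 1); rewrite [1 + _]addrC subrK.
move=> /(_ ltac:(by rewrite ltrBrDr addNr)).
rewrite ln_div ?posrE ?mulr_gt0// lnM ?posrE// => h.
have := ler_wpM2l p0 h.
have -> : p * (v / (Z * p) - 1) = v / Z - p by field; rewrite pn0 gt_eqF.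
by move=> ?; nra.
Qed.

Lemma phiE_leD p q : 0 <= p -> 0 <= q -> phiE (p + q) <= phiE p + phiE q.
Proof.
move=> p0 q0; rewrite /phiE.
case: (eqVneq p 0) => [->|pn0]; first by rewrite !add0r.
case: (eqVneq q 0) => [->|qn0]; first by rewrite !addr0 (negbTE pn0).
have pp : 0 < p by rewrite lt_neqAle eq_sym pn0.
have qq : 0 < q by rewrite lt_neqAle eq_sym qn0.
rewrite gt_eqF ?addr_gt0//.
have lp : ln p <= ln (p + q) by rewrite ler_ln ?posrE ?addr_gt0// lerDl.
have lq : ln q <= ln (p + q) by rewrite ler_ln ?posrE ?addr_gt0// lerDr.
by nra.
Qed.

Lemma phiE_ge0 p : 0 <= p <= 1 -> 0 <= phiE p.
Proof.
move=> /andP[p0 p1]; rewrite /phiE; case: ifP => // _.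
by rewrite oppr_ge0 mulr_ge0_le0// ln_le0.
Qed.

End entropy_function.

(** * Counting words in Hamming balls *)

Section hamming.
Context {R : realType}.

Definition hamming n m (u v : {ffun 'I_n -> 'I_m}) : nat :=
  #|[pred i | u i != v i]|.

(** Exponential weights: giving [v] the weight [b] to the power of its distance to [u] yields total
    weight at most [(1 + m b)^n], while each word of [A] weighs at least [b^(r n)]. The parameter
    [b] stays free: it is chosen small first, and [r] small against [- ln b] afterwards. *)
Lemma hamming_ball n m (b r : R) (u : {ffun 'I_n -> 'I_m})
    (A : {set {ffun 'I_n -> 'I_m}}) : 0 < b <= 1 ->
  (forall v, v \in A -> (hamming v u)%:R <= r * n%:R) ->
  #|A|%:R <= expR (n%:R * (m%:R * b + r * - ln b)).
Proof.
move=> /andP[b0 b1] hA.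
pose wt (v : {ffun 'I_n -> 'I_m}) : R := \prod_i (if v i == u i then 1 else b).
have wt0 v : 0 <= wt v by apply: prodr_ge0 => i _; case: ifP => // _; exact: ltW.
have wtE v : wt v = expR ((hamming v u)%:R * ln b).
  rewrite /wt.
  rewrite (eq_bigr (fun i => if v i != u i then b else 1)); last first.
    by move=> i _; case: eqP.
  rewrite -big_mkcond /= prodr_const expRM_natl lnK ?posrE//.
have sumwt : \sum_v wt v <= expR (n%:R * (m%:R * b)).
  rewrite /wt -(bigA_distr_bigA (fun i j => if j == u i then 1 else b)).
  apply: (@le_trans _ _ (\prod_(i < n) expR (m%:R * b))); last first.
    by rewrite prodr_const cardT size_enum_ord -expRM_natl.
  apply: ler_prod => i _; apply/andP; split.
    by apply: sumr_ge0 => j _; case: ifP => // _; exact: ltW.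
  apply: le_trans (expR_ge1Dx _).
  rewrite (bigD1 (u i))//= eqxx lerD2l.
  rewrite (eq_bigr (fun=> b)); last by move=> j /negbTE ->.
  rewrite sumr_const -[leLHS]mulr_natl (ler_wpM2r (ltW b0))//.
  by rewrite ler_nat (leq_trans (max_card _))// card_ord.
rewrite mulrDr expRD.
apply: (@le_trans _ _ (\sum_(v in A) wt v * expR (n%:R * (r * - ln b)))).
  rewrite -sum1_card natr_sum; apply: ler_sum => v vA.
  rewrite wtE -expRD; apply: le_trans (expR_ge1Dx _).
  rewrite lerDl; have := hA v vA.
  have : ln b <= 0 by rewrite ln_le0.
  by move=> ? ?; nra.
rewrite -mulr_suml ler_wpM2r ?expR_ge0//.
apply: le_trans sumwt; rewrite [leRHS](bigID (mem A))/= lerDl.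
exact: sumr_ge0.
Qed.

Lemma hamming_diam n m (b r : R) (A : {set {ffun 'I_n -> 'I_m}}) : 0 < b <= 1 ->
  (forall u v, u \in A -> v \in A -> (hamming v u)%:R <= r * n%:R) ->
  #|A|%:R <= expR (n%:R * (m%:R * b + r * - ln b)).
Proof.
move=> b01 hA; have [->|[u uA]] := set_0Vmem A.
  by rewrite cards0 expR_ge0.
by apply: (@hamming_ball _ _ b r u) => // v vA; exact: hA.
Qed.

End hamming.

(** * Variable-length codes of orbit segments and Kraft's inequality *)

Section codes.
Context {R : realType} {S : Type} {I : eqType}.
Variables (T : S -> S) (s : seq I) (l : I -> nat) (B : I -> set S) (w : I -> R).

(** Words over [s] of total length exactly [n]. The fuel makes the recursion structural; [n] units
    of it suffice because letters have positive length. *)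
Fixpoint codes (fuel n : nat) : seq (seq I) :=
  if n is 0%N then [:: [::]] else
  if fuel is k.+1 then
    flatten [seq [seq i :: c | c <- codes k (n - l i)] | i <- s & (l i <= n)%N]
  else [::].

Definition cweight (c : seq I) : R := \prod_(i <- c) w i.

Fixpoint is_code (c : seq I) (n : nat) (x : S) : Prop :=
  if c is i :: c' then
    [/\ i \in s, (l i <= n)%N, B i x & is_code c' (n - l i) (iter (l i) T x)]
  else n = 0%N.

Hypothesis l_gt0 : forall i, i \in s -> (0 < l i)%N.

Lemma is_code_mem c n x fuel : is_code c n x -> (n <= fuel)%N ->
  c \in codes fuel n.
Proof.
elim: c n x fuel => [|i c IH] n x fuel.
  by move=> /= -> _; case: fuel => [|k]; rewrite /= inE.
move=> /= [is_ lin _ ic] nf; have li := l_gt0 is_.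
case: n fuel lin ic nf => [|n] [|fuel]/= lin ic nf //; try lia.
apply/flatten_mapP; exists i; first by rewrite mem_filter lin is_.
by apply: map_f; apply: IH ic _; lia.
Qed.

Lemma is_code_cat c d n m x : is_code c n x -> is_code d m (iter n T x) ->
  is_code (c ++ d) (n + m)%N x.
Proof.
elim: c n x => [|i c IH] n x /=; first by move=> ->.
move=> [is_ lin Bx ic] id; split => //; first lia.
rewrite -addnBAC//; apply: IH => //.
by rewrite -iterD subnK.
Qed.

Lemma cweight_cat c d : cweight (c ++ d) = cweight c * cweight d.
Proof. by rewrite /cweight big_cat. Qed.

Hypothesis w_ge0 : forall i, i \in s -> 0 <= w i.
Hypothesis w_le1 : \sum_(i <- s) w i <= 1.

(** Induction on the first letter. If the weights are probabilities of independent steps of lengths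
    [l i], the sum is the probability that the resulting walk ever hits [n], whatever the relation
    between weights and lengths. *)
Lemma kraft fuel n : \sum_(c <- codes fuel n) cweight c <= 1.
Proof.
elim: fuel n => [|k IH] [|n]/=.
- by rewrite big_seq1 /cweight big_nil.
- by rewrite big_nil ler01.
- by rewrite big_seq1 /cweight big_nil.
rewrite big_flatten/= big_map big_filter.
apply: le_trans w_le1; rewrite big_mkcond big_seq [leRHS]big_seq.
apply: ler_sum => i is_; case: ifP => _; last exact: w_ge0.
rewrite big_map; under eq_bigr do rewrite /cweight big_cons.
by rewrite -mulr_sumr ler_piMr ?w_ge0.
Qed.

End codes.

(** * Birkhoff sums and averaging over phases *)

Section birkhoff_sum.
Context {R : realType} {S : Type}.
Variable T : S -> S.

Definition bsum (g : S -> R) n x := \sum_(i < n) g (iter i T x).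

Lemma bsumS g n x : bsum g n.+1 x = g x + bsum g n (T x).
Proof.
rewrite /bsum big_ord_recl/=; congr (_ + _).
by apply: eq_bigr => i _; rewrite -iterSr.
Qed.

Lemma bsumSr g n x : bsum g n.+1 x = bsum g n x + g (iter n T x).
Proof. by rewrite /bsum big_ord_recr. Qed.

Lemma bsum_add g n m x : bsum g (n + m) x = bsum g n x + bsum g m (iter n T x).
Proof.
elim: m => [|m IH]; first by rewrite addn0 /bsum big_ord0 addr0.
by rewrite addnS !bsumSr IH addrA -iterD addnC.
Qed.

Lemma bsum_ge (M : R) g n x : (forall y, - M <= g y) ->
  - (n%:R * M) <= bsum g n x.
Proof.
move=> gM; rewrite -mulrN mulr_natl -[n in leLHS]card_ord -sumr_const.
exact: ler_sum.
Qed.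

Lemma bsum_blocks g k q x :
  \sum_(j < k) \sum_(i < q) g (iter (i * k + j) T x) = bsum g (q * k) x.
Proof.
rewrite exchange_big/=; elim: q => [|q IH].
  by rewrite big_ord0 /bsum mul0n big_ord0.
rewrite big_ord_recr/= IH mulSnr bsum_add; congr (_ + _).
by apply: eq_bigr => j _; rewrite -iterD addnC.
Qed.

(* [Q n x r] reads "the cost of the orbit segment of length [n] starting at [x]
   is at most [r]". *)
Lemma subadd_avg (Q : nat -> S -> R -> Prop) (C M : R) (k : nat) (g : S -> R) :
  (0 < k)%N -> 0 <= C -> 0 <= M -> (forall y, - M <= g y) ->
  (forall x, Q 0%N x 0) ->
  (forall x, Q 1%N x C) ->
  (forall x, Q k x (g x)) ->
  (forall n m x a b, Q n x a -> Q m (iter n T x) b -> Q (n + m)%N x (a + b)) ->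
  (forall n x a b, Q n x a -> a <= b -> Q n x b) ->
  forall n x, (k <= n)%N ->
    Q n x (k%:R^-1 * bsum g n x + 2 * k%:R * C + 2 * M).
Proof.
move=> k0 C0 M0 gM Q0 Q1 Qk QD Qle n x kn.
have Qsingle j y : Q j y (j%:R * C).
  elim: j => [|j IH]; first by rewrite mul0r.
  by rewrite -addn1 natrD mulrDl mul1r; exact: QD.
have Qblocks q y : Q (q * k)%N y (\sum_(i < q) g (iter (i * k) T y)).
  elim: q => [|q IH]; first by rewrite big_ord0.
  by rewrite mulSnr big_ord_recr/=; exact: QD.
(* One block fewer than fits, so that [q] blocks fit from every starting phase [j < k]; fewer than
   [2 * k] time steps are then left over at the two ends together. *)
pose q := (n %/ k).-1.
have dk : (0 < n %/ k)%N by rewrite divn_gt0.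
have qk : (q * k + k = n %/ k * k)%N by rewrite -mulSnr /q prednK.
have nE := divn_eq n k; have rk := ltn_pmod n k0.
have kR : (0 : R) < k%:R by rewrite ltr0n.
pose a (j : 'I_k) := \sum_(i < q) g (iter (i * k + j) T x).
have Qj (j : 'I_k) : Q n x (a j + 2 * k%:R * C).
  have jk := ltn_ord j.
  have -> : n = (j + q * k + (n - (j + q * k)))%N by lia.
  apply: Qle (QD _ _ _ _ _ (QD _ _ _ _ _ (Qsingle _ _) (Qblocks _ _)) (Qsingle _ _)) _.
  rewrite addrAC [leRHS]addrC.
  apply: lerD; last by rewrite /a; under eq_bigr do rewrite -iterD.
  rewrite -mulrDl ler_wpM2r// -natrD -natrM ler_nat; lia.
have sa : \sum_j a j <= bsum g n x + 2 * k%:R * M.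
  rewrite /a bsum_blocks.
  have -> : n = (q * k + (n - q * k))%N by lia.
  rewrite bsum_add -addrA lerDl.
  have := @bsum_ge M g (n - q * k) (iter (q * k) T x) gM.
  have : (n - q * k)%:R <= 2 * k%:R :> R by rewrite -natrM ler_nat; lia.
  by move=> ? ?; nra.
(* The phases together run through a full Birkhoff sum, so some phase costs at most their
   average. *)
have [j aj] : exists j, a j <= k%:R^-1 * (bsum g n x + 2 * k%:R * M).
  apply: contrapT => /forallNP h.
  have : \sum_j a j > \sum_(j < k) k%:R^-1 * (bsum g n x + 2 * k%:R * M).
    apply: ltr_sum; first by apply/hasP; exists (Ordinal k0) => //; exact: mem_index_enum.
    by move=> j _; rewrite ltNge; apply/negP; exact: h.
  rewrite sumr_const card_ord -[_ *+ k]mulr_natl mulrA divff ?gt_eqF// mul1r.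
  by rewrite ltNge sa.
apply: Qle (Qj j) _.
rewrite [leRHS]addrAC lerD2r (le_trans aj)// mulrDr lerD2l.
by rewrite mulrCA -mulrA mulVKf ?gt_eqF.
Qed.

End birkhoff_sum.

Section fekete.
Context {R : realType}.

Lemma fekete (a : nat -> R) : (forall n, 0 <= a n) -> a 0%N = 0 ->
  (forall n m, a (n + m)%N <= a n + a m) ->
  n%:R^-1 * a n @[n --> \oo] --> inf [set k%:R^-1 * a k | k in [set k | (0 < k)%N]].
Proof.
move=> a0 a00 aD; set A := [set _ | _ in _]; set L := inf A.
have hA : has_inf A.
  split; first by exists (1%:R^-1 * a 1%N), 1%N.
  by exists 0 => _ [k _ <-]; rewrite mulr_ge0// invr_ge0.
apply/cvgrPdist_le => e e0.
have [_ [k k0 <-] kL] := inf_adherent (divr_gt0 e0 (ltr0n R 2)) hA.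
rewrite -/L in kL.
near=> n.
have n0 : (0 < n)%N by near: n; exact: nbhs_infty_gt.
have nR : (0 : R) < n%:R by rewrite ltr0n.
have kn : (k <= n)%N by near: n; exact: nbhs_infty_ge.
(* A numerical sequence is a cost on the one-point system; the Birkhoff sum of the constant [a k] is
   then [n * a k]. *)
have := @subadd_avg R unit id (fun n _ r => a n <= r) (a 1%N) 0 k (fun=> a k) k0
  (a0 _) (lexx _) _ _ _ _ _ _ n tt kn.
rewrite oppr0 mulr0 addr0 => /(_ ltac:(by []) ltac:(by rewrite a00) ltac:(by [])).
move=> /(_ ltac:(by [])) /(_ ltac:(by move=> ? ? _ ? ? ? ?; exact: le_trans (aD _ _) (lerD _ _))).
move=> /(_ ltac:(by move=> ? _ ? ? /le_trans h ?; exact: h)).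
rewrite /bsum sumr_const card_ord -[a k *+ n]mulr_natl => h.
have L1 : L <= n%:R^-1 * a n by apply: ge_inf; [case: hA|exists n].
rewrite distrC ger0_norm ?subr_ge0// lerBlDl.
have : n%:R^-1 * a n <= n%:R^-1 * (k%:R^-1 * (n%:R * a k) + 2 * k%:R * a 1%N).
  by rewrite ler_pM2l ?invr_gt0.
rewrite mulrDr mulrCA mulKf ?gt_eqF// => /le_trans; apply.
have : n%:R^-1 * (2 * k%:R * a 1%N) <= e / 2.
  rewrite ler_pdivrMl// -ler_pdivrMr ?divr_gt0//.
  near: n; exact: nbhs_infty_ger.
lra.
Unshelve. all: by end_near.
Qed.

End fekete.

(** * Invariant measures and the maximal ergodic theorem *)

Section probability_toolkit.
Context d {S : measurableType d} {R : realType} (mu : probability S R).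

Definition pr (A : set S) : R := fine (mu A).

Lemma prE A : measurable A -> (pr A)%:E = mu A.
Proof. by move=> mA; rewrite /pr fineK// fin_num_measure. Qed.

Lemma pr_ge0 A : 0 <= pr A.
Proof. by rewrite /pr fine_ge0. Qed.

Lemma pr_le A B : measurable A -> measurable B -> A `<=` B -> pr A <= pr B.
Proof. by move=> mA mB AB; rewrite -lee_fin !prE// le_measure ?mem_set. Qed.

Lemma pr_setT : pr setT = 1.
Proof. by rewrite /pr probability_setT. Qed.

Lemma pr_le1 A : measurable A -> pr A <= 1.
Proof. by move=> mA; rewrite -pr_setT; exact: pr_le. Qed.

Lemma pr_setC A : measurable A -> pr (~` A) = 1 - pr A.
Proof.
move=> mA; apply: EFin_inj.
by rewrite prE ?probability_setC//; [rewrite -prE//|exact: measurableC].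
Qed.

Lemma pr_leU A B C : measurable A -> measurable B -> measurable C ->
  A `<=` B `|` C -> pr A <= pr B + pr C.
Proof.
move=> mA mB mC ABC; rewrite -lee_fin EFinD !prE//.
apply: (le_trans _ (measureU2 mu mB mC)).
by rewrite le_measure ?mem_set//; exact: measurableU.
Qed.

Lemma pr_setD A B : measurable A -> measurable B -> B `<=` A ->
  pr (A `\` B) = pr A - pr B.
Proof.
move=> mA mB BA; rewrite /pr measureD ?setIidr//.
  by rewrite fineB// fin_num_measure.
by rewrite ltey_eq fin_num_measure.
Qed.

Lemma pr_bigcup_approx (U : (set S)^nat) (e : R) : (forall n, measurable (U n)) ->
  nondecreasing_seq U -> 0 < e -> exists n, pr (\bigcup_k U k) - e <= pr (U n).
Proof.
move=> mU ndU e0.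
have mUU : measurable (\bigcup_k U k) by exact: bigcup_measurable.
have : mu (U n) @[n --> \oo] --> (pr (\bigcup_k U k))%:E.
  by rewrite prE//; exact: nondecreasing_cvg_mu.
move=> /fine_cvgP[_ /cvgrPdist_le/(_ _ e0)[N _ /(_ N (leqnn N))]].
rewrite /= -/(pr _) ler_norml => /andP[_ h]; exists N.
by rewrite lerBlDr -lerBlDl.
Qed.

Lemma pr_bigcap_approx (U : (set S)^nat) (e : R) : (forall n, measurable (U n)) ->
  nonincreasing_seq U -> 0 < e -> exists n, pr (U n) <= pr (\bigcap_k U k) + e.
Proof.
move=> mU niU e0.
have [] := @pr_bigcup_approx (fun n => ~` U n) e _ _ e0.
- by move=> n; exact: measurableC.
- by move=> n m nm; apply/subsetPset/subsetC/subsetPset; exact: niU.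
move=> n; rewrite -setC_bigcap !pr_setC//; last exact: bigcap_measurable.
by move=> h; exists n; lra.
Qed.

Definition bmeas (g : S -> R) :=
  measurable_fun setT g /\ exists M, forall x, `|g x| <= M.

Lemma bmeas_int g : bmeas g -> mu.-integrable setT (EFin \o g).
Proof.
move=> [mg [M gM]]; apply: measurable_bounded_integrable => //.
  by rewrite ltey_eq fin_num_measure.
exists M; split; first exact: num_real.
by move=> y My x _ /=; rewrite (le_trans (gM x))// ltW.
Qed.

Lemma bmeas_cst c : bmeas (cst c).
Proof. by split; [exact: measurable_cst|exists `|c|]. Qed.

Lemma bmeasD g h : bmeas g -> bmeas h -> bmeas (fun x => g x + h x).
Proof.
move=> [mg [M gM]] [mh [N hN]]; split; first exact: measurable_funD.
by exists (M + N) => x; rewrite (le_trans (ler_normD _ _))// lerD.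
Qed.

Lemma bmeasZ c g : bmeas g -> bmeas (fun x => c * g x).
Proof.
move=> [mg [M gM]]; split; first exact: measurable_funM.
by exists (`|c| * M) => x; rewrite normrM ler_wpM2l.
Qed.

Lemma bmeas_max0 g : bmeas g -> bmeas (fun x => Num.max 0 (g x)).
Proof.
move=> [mg [M gM]]; split; first exact: measurable_maxr.
by exists M => x; rewrite (le_trans _ (gM x))//; case: (leP 0 (g x)); rewrite ?normr0.
Qed.

Lemma bmeas_indic A : measurable A -> bmeas \1_A.
Proof.
move=> mA; split; first exact: measurable_indic.
by exists 1 => x; rewrite indicE ger0_norm ?ler0n// lern1 leq_b1.
Qed.

Lemma bmeas_sum (I : Type) (s : seq I) (P : pred I) (g : I -> S -> R) :
  (forall i, bmeas (g i)) -> bmeas (fun x => \sum_(i <- s | P i) g i x).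
Proof.
move=> bg; elim: s => [|i s IH].
  by under eq_fun do rewrite big_nil; exact: bmeas_cst.
under eq_fun do rewrite big_cons.
by case: (P i) => //; exact: bmeasD.
Qed.

Lemma int_cst c : \int[mu]_x c = c.
Proof. by rewrite Rintegral_cst// -/(pr _) pr_setT mulr1. Qed.

Lemma int_D g h : bmeas g -> bmeas h ->
  \int[mu]_x (g x + h x) = \int[mu]_x g x + \int[mu]_x h x.
Proof. by move=> bg bh; rewrite RintegralD//; exact: bmeas_int. Qed.

Lemma int_Z c g : bmeas g -> \int[mu]_x (c * g x) = c * \int[mu]_x g x.
Proof. by move=> bg; rewrite RintegralZl//; exact: bmeas_int. Qed.

Lemma int_le g h : bmeas g -> bmeas h -> (forall x, g x <= h x) ->
  \int[mu]_x g x <= \int[mu]_x h x.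
Proof. by move=> bg bh gh; apply: le_Rintegral => //; exact: bmeas_int. Qed.

Lemma int_indic A : measurable A -> \int[mu]_x \1_A x = pr A.
Proof. by move=> mA; rewrite /Rintegral integral_indic// setIT. Qed.

Lemma int_sum (I : Type) (s : seq I) (P : pred I) (g : I -> S -> R) :
  (forall i, bmeas (g i)) ->
  \int[mu]_x (\sum_(i <- s | P i) g i x) = \sum_(i <- s | P i) \int[mu]_x g i x.
Proof.
move=> bg; elim: s => [|i s IH].
  by rewrite big_nil; under eq_Rintegral do rewrite big_nil; exact: int_cst.
under eq_Rintegral do rewrite big_cons.
rewrite big_cons; case: (P i) => //.
by rewrite int_D// ?IH//; exact: bmeas_sum.
Qed.

Lemma pr_sum (W : finType) (A : W -> set S) (E : set S) :
  (forall w, measurable (A w)) -> measurable E ->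
  (forall u w, u != w -> A u `&` A w = set0) -> (forall x, exists w, A w x) ->
  \sum_w pr (A w `&` E) = pr E.
Proof.
move=> mA mE dA cA; have mI w : measurable (A w `&` E) by exact: measurableI.
rewrite -int_indic//; under eq_bigr do rewrite -int_indic//.
rewrite -int_sum; last by move=> w; exact: bmeas_indic.
apply: eq_Rintegral => x _; have [w Aw] := cA x.
rewrite (bigD1 w)//= big1 => [|u uw].
  rewrite addr0 !indicE; congr (_%:R); congr (nat_of_bool _).
  by apply/idP/idP => /set_mem h; apply/mem_set; [case: h|split].
rewrite indicE memNset// => -[Au _].
by have := dA _ _ uw; rewrite -subset0 => /(_ x); apply.
Qed.

(** * Measure-preserving maps *)

Section measure_preserving.
Variable T : S -> S.
Hypothesis mT : measurable_fun setT T.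
Hypothesis invT : forall A, measurable A -> mu (T @^-1` A) = mu A.

Lemma measurable_iter n : measurable_fun setT (iter n T).
Proof.
elim: n => [|n IH]; first exact: measurable_id.
exact: (measurableT_comp mT IH).
Qed.

Lemma bmeas_comp g n : bmeas g -> bmeas (fun x => g (iter n T x)).
Proof.
move=> [mg [M gM]]; split; last by exists M.
by apply: measurableT_comp => //; exact: measurable_iter.
Qed.

Lemma bmeas_bsum g n : bmeas g -> bmeas (bsum T g n).
Proof. by move=> bg; apply: bmeas_sum => i; exact: bmeas_comp. Qed.

Lemma pr_iter A n : measurable A -> pr (iter n T @^-1` A) = pr A.
Proof.
move=> mA; elim: n => [//|n IH]; rewrite -IH /pr.
rewrite [X in mu X](_ : _ = T @^-1` (iter n T @^-1` A)) ?invT//.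
  by rewrite -[X in measurable X]setTI; exact: measurable_iter.
by apply/seteqP; split => x /=; rewrite -iterSr.
Qed.

Lemma int_comp1 g : bmeas g -> \int[mu]_x g (T x) = \int[mu]_x g x.
Proof.
move=> bg; rewrite /Rintegral; congr fine.
have ig : mu.-integrable (T @^-1` setT) ((EFin \o g) \o T).
  rewrite preimage_setT; apply: bmeas_int; exact: (bmeas_comp 1 bg).
have := integral_pushforward mT _ ig measurableT.
rewrite preimage_setT => <-; last by apply/measurable_EFinP; case: bg.
apply: eq_measure_integral => A mA _; exact: invT.
Qed.

Lemma int_comp g n : bmeas g -> \int[mu]_x g (iter n T x) = \int[mu]_x g x.
Proof.
move=> bg; elim: n => [//|n IH].
by rewrite -IH -(int_comp1 (bmeas_comp n bg)); under eq_Rintegral do rewrite iterSr.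
Qed.

Lemma int_bsum g n : bmeas g -> \int[mu]_x bsum T g n x = n%:R * \int[mu]_x g x.
Proof.
move=> bg; rewrite /bsum int_sum => [|i]; last exact: bmeas_comp.
rewrite (eq_bigr (fun=> \int[mu]_x g x)); last by move=> i _; exact: int_comp.
by rewrite sumr_const card_ord [RHS]mulr_natl.
Qed.

Lemma measurable_le_fun (g : S -> R) c : bmeas g -> measurable [set x | g x <= c].
Proof.
move=> [mg _]; rewrite (_ : [set _ | _] = g @^-1` `]-oo, c]).
  by rewrite -[X in measurable X]setTI; exact: mg.
by apply/seteqP; split => x /=; rewrite in_itv.
Qed.

(** Markov's inequality: by invariance the expected number of visits to [A] before time [n] is
    [n * pr A]. *)
Lemma rare_visits A n (k e : R) : measurable A -> 0 < k -> (0 < n)%N ->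
  pr A <= k * e -> 1 - e <= pr [set x | bsum T \1_A n x <= k * n%:R].
Proof.
move=> mA k0 n0 Ae.
have bS : bmeas (bsum T \1_A n) by apply: bmeas_bsum; exact: bmeas_indic.
set G := [set x | _]; have mG : measurable G by exact: measurable_le_fun.
have n0' : (0 : R) < n%:R by rewrite ltr0n.
have kn : 0 < k * n%:R by rewrite mulr_gt0.
suff : pr (~` G) <= e by rewrite pr_setC//; lra.
have mGC := measurableC mG.
have : \int[mu]_x (k * n%:R * \1_(~` G) x) <= \int[mu]_x bsum T \1_A n x.
  apply: int_le => //; first by apply: bmeasZ; exact: bmeas_indic.
  move=> x; rewrite indicE; case: (asboolP ((~` G) x)) => xG.
    rewrite mem_set// mulr1 ltW// ltNge; apply/negP => h; exact: xG.
  rewrite memNset// mulr0; apply: sumr_ge0 => i _; exact: ler0n.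
rewrite int_Z; last exact: bmeas_indic.
rewrite int_indic// int_bsum; last exact: bmeas_indic.
rewrite int_indic// -mulrA mulrCA ler_pM2l//.
move=> h; rewrite -(ler_pM2l k0); exact: le_trans h Ae.
Qed.

Section maximal.
Variable g : S -> R.
Hypothesis bg : bmeas g.

(* [maxsum n] is the maximum of the Birkhoff sums of lengths [1], ..., [n + 1]. *)
Fixpoint maxsum (n : nat) : S -> R :=
  if n is k.+1 then fun x => g x + Num.max 0 (maxsum k (T x)) else g.

Lemma bmeas_maxsum n : bmeas (maxsum n).
Proof.
elim: n => [//|n IH] /=; apply: bmeasD => //.
by apply: bmeas_max0; exact: (bmeas_comp 1 IH).
Qed.

Lemma maxsumS n x : maxsum n x <= maxsum n.+1 x.
Proof.
elim: n x => [|n IH] x; first by rewrite /= lerDl le_max lexx.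
by rewrite [leLHS]/= [leRHS]/= lerD2l ge_max !le_max lexx/= IH orbT.
Qed.

Lemma bsum_maxsum n x : bsum T g n.+1 x <= maxsum n x.
Proof.
elim: n x => [|n IH] x; first by rewrite /bsum big_ord1.
by rewrite bsumS /= lerD2l le_max IH orbT.
Qed.

(** Integrate [maxsum n <= maxsum n.+1 = g + max 0 (maxsum n \o T)]. By invariance [T] disappears,
    and writing the positive part of [maxsum n] as [maxsum n] plus its negative part lets the
    integral of [maxsum n] cancel. *)
Lemma maximal_inequality n : 0 <= \int[mu]_x (g x + Num.max 0 (- maxsum n x)).
Proof.
have bN h : bmeas h -> bmeas (fun x => - h x).
  by move=> bh; under eq_fun do rewrite -mulN1r; exact: bmeasZ.
have bM := bmeas_maxsum n; have bM0 := bmeas_max0 bM.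
have bN0 := bmeas_max0 (bN _ bM).
have h1 : \int[mu]_x maxsum n x <= \int[mu]_x maxsum n.+1 x.
  apply: int_le => // [|x]; [exact: bmeas_maxsum|exact: maxsumS].
have h2 : \int[mu]_x maxsum n.+1 x =
    \int[mu]_x g x + \int[mu]_x Num.max 0 (maxsum n x).
  rewrite -[in RHS](int_comp1 bM0) -int_D//; exact: (bmeas_comp 1 bM0).
have h3 : \int[mu]_x Num.max 0 (maxsum n x) =
    \int[mu]_x maxsum n x + \int[mu]_x Num.max 0 (- maxsum n x).
  rewrite -int_D//; apply: eq_Rintegral => x _.
  by case: (leP 0 (maxsum n x)) => ?; case: (leP 0 (- maxsum n x)) => ?; lra.
rewrite int_D//; lra.
Qed.

End maximal.

Definition bsum_below (g : S -> R) (C : nat) : set S :=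
  [set x | forall n, bsum T g n x <= C%:R].

Lemma measurable_bsum_below g C : bmeas g -> measurable (bsum_below g C).
Proof.
move=> bg; rewrite (_ : bsum_below g C = \bigcap_n [set x | bsum T g n x <= C%:R]).
  by apply: bigcap_measurable => // n _; apply: measurable_le_fun; exact: bmeas_bsum.
by apply/seteqP; split => x h n //=; exact: h.
Qed.

Lemma bsum_below_homo g : nondecreasing_seq (bsum_below g).
Proof.
move=> n m nm; apply/subsetPset => x h k.
by rewrite (le_trans (h k))// ler_nat.
Qed.

Hypothesis ergT : forall A, measurable A -> T @^-1` A = A -> mu A = 0%E \/ mu A = 1%E.

(* If [G] had measure zero, the maximal function would be eventually nonnegative
   almost everywhere and the maximal inequality would force [g] to have
   nonnegative integral. *)
Lemma ergodic_bsum_bounded g : bmeas g -> \int[mu]_x g x < 0 ->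
  pr (\bigcup_C bsum_below g C) = 1.
Proof.
move=> bg g0; set G := \bigcup_C _.
have [_ [M gM]] := bg.
have mG : measurable G by apply: bigcup_measurable => C _; exact: measurable_bsum_below.
(* Shifting the starting point by one step changes the Birkhoff sums by at most [m], so passing from
   [C] to [C + m] makes [G] exactly invariant. *)
pose m : nat := (Num.truncn M).+1.
have gm x : `|g x| <= m%:R.
  rewrite (le_trans (gM x))// ltW// /m.
  have M0 : 0 <= M by rewrite (le_trans _ (gM x)).
  by have /andP[] := truncn_itv M0.
have TG : T @^-1` G = G.
  apply/seteqP; split => x [C _ xC]; exists (C + m)%N => // n.
    case: n => [|n]; first by rewrite /bsum big_ord0.
    have := xC n; have := gm x; rewrite bsumS natrD ler_norml => /andP[_ ? ?]; lra.
  have := xC n.+1; rewrite bsumS natrD.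
  by have := gm x; rewrite ler_norml => /andP[? ?] ?; lra.
have [G0|G1] := ergT mG TG; last by rewrite /pr G1.
exfalso.
pose U n := [set x | maxsum g n x < 0].
have mU n : measurable (U n).
  rewrite (_ : U n = ~` [set x | - maxsum g n x <= 0]); last first.
    by apply/seteqP; split => x; rewrite /U/= oppr_le0 ltNge => /negP.
  apply/measurableC/measurable_le_fun.
  by under eq_fun do rewrite -mulN1r; apply: bmeasZ; exact: bmeas_maxsum.
have niU : nonincreasing_seq U.
  apply/nonincreasing_seqP => n; apply/subsetPset => x; rewrite /U/=.
  exact/le_lt_trans/maxsumS.
have U0 : pr (\bigcap_n U n) = 0.
  apply/le_anti; rewrite pr_ge0 andbT.
  have <- : pr G = 0 by rewrite /pr G0.
  apply: pr_le => //; first exact: bigcap_measurable.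
  move=> x xU; exists 0%N => // -[|n]; first by rewrite /bsum big_ord0.
  rewrite (le_trans (bsum_maxsum _ _ _))// ltW//; exact: xU.
(* On [U n] the negative part of [maxsum n] is at most [- g], hence at most [m]. With this [e] its
   integral is at most half of [- \int g], which contradicts the maximal inequality. *)
pose e := - (\int[mu]_x g x) / (2 * m%:R).
have m0 : (0 : R) < m%:R by rewrite ltr0n.
have e0 : 0 < e by rewrite divr_gt0 ?mulr_gt0// oppr_gt0.
have [n] := pr_bigcap_approx mU niU e0; rewrite U0 add0r => Ue.
have := maximal_inequality bg n; rewrite leNgt => /negP; apply.
apply: (@le_lt_trans _ _ (\int[mu]_x (g x + m%:R * \1_(U n) x))).
  apply: int_le.
  - apply: bmeasD => //; apply: bmeas_max0.
    by under eq_fun do rewrite -mulN1r; apply: bmeasZ; exact: bmeas_maxsum.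
  - by apply: bmeasD => //; apply: bmeasZ; exact: bmeas_indic.
  move=> x; rewrite lerD2l indicE.
  have [xU|xU] := ltP (maxsum g n x) 0.
    rewrite mem_set// mulr1 ge_max ltW//=.
    have : g x <= maxsum g n x.
      elim: n {mU niU U0 Ue xU} => [//|n IH]; exact: le_trans IH (maxsumS _ _ _).
    by have := gm x; rewrite ler_norml => /andP[? ?] ?; lra.
  rewrite memNset; last by rewrite /U/=; apply/negP; rewrite -leNgt.
  by rewrite mulr0 ge_max lexx/= oppr_le0.
rewrite int_D//; last by apply: bmeasZ; exact: bmeas_indic.
rewrite int_Z; last exact: bmeas_indic.
rewrite int_indic//.
have : m%:R * pr (U n) <= m%:R * e by rewrite ler_pM2l.
have -> : m%:R * e = - (\int[mu]_x g x) / 2 by rewrite /e; field; rewrite gt_eqF.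
lra.
Qed.

End measure_preserving.
End probability_toolkit.

(** * Entropy of a partition *)

Section partition_entropy.
Context d {S : measurableType d} {R : realType} (mu : probability S R).
Variable T : S -> S.
Hypothesis mT : measurable_fun setT T.
Hypothesis invT : forall A, measurable A -> mu (T @^-1` A) = mu A.
Context (m : nat) (P : 'I_m -> set S).
Hypothesis mP : forall i, measurable (P i).
Hypothesis dP : forall i j, i != j -> P i `&` P j = set0.
Hypothesis cP : forall x, exists i, P i x.

Local Notation pr := (pr mu).

Definition cyl n (w : {ffun 'I_n -> 'I_m}) : set S :=
  [set y | forall i, P (w i) (iter i T y)].

Definition entropy n : R := \sum_(w : {ffun 'I_n -> 'I_m}) phiE (pr (cyl w)).

Lemma measurable_cyl n (w : {ffun 'I_n -> 'I_m}) : measurable (cyl w).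
Proof.
rewrite (_ : cyl w = \bigcap_(i in [set` 'I_n]) (iter i T @^-1` P (w i))).
  apply: fin_bigcap_measurable => // i _.
  by rewrite -[X in measurable X]setTI; exact: measurable_iter.
by apply/seteqP; split => x h i //=; exact: h.
Qed.

Lemma cyl_inj n (u w : {ffun 'I_n -> 'I_m}) x : cyl u x -> cyl w x -> u = w.
Proof.
move=> ux wx; apply/ffunP => i; apply/eqP/negPn/negP => /dP.
by rewrite -subset0 => /(_ (iter i T x)); apply; split.
Qed.

Lemma cyl_disj n (u w : {ffun 'I_n -> 'I_m}) : u != w -> cyl u `&` cyl w = set0.
Proof.
move=> uw; rewrite -subset0 => x [ux wx].
by move/eqP : uw; apply; exact: cyl_inj ux wx.
Qed.

Lemma cyl_ex n x : exists w : {ffun 'I_n -> 'I_m}, cyl w x.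
Proof.
exists [ffun i : 'I_n => projT1 (cid (cP (iter i T x)))] => i.
by rewrite ffunE; case: cid.
Qed.

Lemma sum_pr_cyl n E : measurable E ->
  \sum_(w : {ffun 'I_n -> 'I_m}) pr (cyl w `&` E) = pr E.
Proof.
move=> mE; apply: pr_sum => //; last exact: cyl_ex.
  by move=> w; exact: measurable_cyl.
by move=> u w; exact: cyl_disj.
Qed.

Lemma partition_gt0 (x : S) : (0 < m)%N.
Proof. by case: (cP x) => -[i im] _; exact: leq_ltn_trans im. Qed.

Lemma sum_pr_cyl1 n : \sum_(w : {ffun 'I_n -> 'I_m}) pr (cyl w) = 1.
Proof.
rewrite -(pr_setT mu) -(sum_pr_cyl n measurableT).
by apply: eq_bigr => w _; rewrite setIT.
Qed.

Lemma sum_uniform n : \sum_(w : {ffun 'I_n -> 'I_m}) ((m%:R ^+ n)^-1 : R) = 1.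
Proof.
have m0 : (0 < m)%N by exact: (partition_gt0 point).
rewrite sumr_const card_ffun !card_ord -[LHS]mulr_natr natrX mulVf//.
by rewrite expf_neq0// pnatr_eq0 -lt0n.
Qed.

Lemma entropy_ge0 n : 0 <= entropy n.
Proof.
apply: sumr_ge0 => w _; apply: phiE_ge0.
by rewrite pr_ge0 pr_le1//; exact: measurable_cyl.
Qed.

Lemma entropy0 : entropy 0 = 0.
Proof.
rewrite /entropy big1// => w _.
rewrite (_ : cyl w = setT) ?pr_setT ?phiEE ?ln1 ?mulr0 ?oppr0//.
by apply/seteqP; split => // x _ [].
Qed.

Definition ffun_cat n p (u : {ffun 'I_n -> 'I_m}) (v : {ffun 'I_p -> 'I_m}) :
    {ffun 'I_(n + p) -> 'I_m} :=
  [ffun i => match fintype.split i with inl j => u j | inr j => v j end].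

Lemma cyl_cat n p (u : {ffun 'I_n -> 'I_m}) (v : {ffun 'I_p -> 'I_m}) :
  cyl (ffun_cat u v) = cyl u `&` (iter n T @^-1` cyl v).
Proof.
apply/seteqP; split => x.
  move=> h; split => i /=.
    have := h (lshift p i); rewrite ffunE.
    by rewrite (_ : fintype.split _ = inl i)// -[lshift p i]/(unsplit (inl i)) unsplitK.
  have := h (rshift n i); rewrite ffunE -iterD [(i + n)%N]addnC.
  by rewrite (_ : fintype.split _ = inr i)// -[rshift n i]/(unsplit (inr i)) unsplitK.
move=> [/= hu hv] i; rewrite ffunE.
case: splitP => j ij; rewrite ij; first exact: hu.
by rewrite addnC iterD; exact: hv.
Qed.

Lemma sum_ffun_cat n p (F : {ffun 'I_(n + p) -> 'I_m} -> R) :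
  \sum_w F w = \sum_u \sum_v F (ffun_cat u v).
Proof.
rewrite pair_big/=.
rewrite (reindex (fun uv : {ffun 'I_n -> 'I_m} * {ffun 'I_p -> 'I_m} =>
  ffun_cat uv.1 uv.2))//=.
exists (fun w : {ffun 'I_(n + p) -> 'I_m} =>
  ([ffun i => w (lshift p i)], [ffun i => w (rshift n i)])) => [[u v] _|w _] /=.
  congr pair; apply/ffunP => i; rewrite !ffunE.
    by rewrite -[lshift p i]/(unsplit (inl i)) unsplitK.
  by rewrite -[rshift n i]/(unsplit (inr i)) unsplitK.
apply/ffunP => i; rewrite ffunE; case: splitP => j ij; rewrite ffunE.
  by congr (w _); exact: val_inj.
by congr (w _); exact: val_inj.
Qed.

(** Gibbs' inequality with the product weights [pr (cyl u) * pr (cyl v)], that is, nonnegativity of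
    mutual information. Invariance identifies the second marginal of the joint masses [q]. *)
Lemma entropyD n p : entropy (n + p) <= entropy n + entropy p.
Proof.
pose q u v := pr (cyl (@ffun_cat n p u v)).
have mc k (w : {ffun 'I_k -> 'I_m}) := measurable_cyl w.
have mi (v : {ffun 'I_p -> 'I_m}) : measurable (iter n T @^-1` cyl v).
  by rewrite -[X in measurable X]setTI; exact: measurable_iter.
have qu u : \sum_v q u v = pr (cyl u).
  rewrite /q; under eq_bigr do rewrite cyl_cat setIC.
  apply: pr_sum => // [v w vw|x]; last exact: cyl_ex.
  by rewrite -preimage_setI cyl_disj// preimage_set0.
have qv v : \sum_u q u v = pr (cyl v).
  rewrite /q; under eq_bigr do rewrite cyl_cat.
  rewrite -(pr_iter mT invT n (mc _ v)).
  apply: pr_sum => //; [by move=> ? ?; exact: cyl_disj|exact: cyl_ex].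
have q0 u v : 0 <= q u v by exact: pr_ge0.
have qle_u u v : q u v <= pr (cyl u).
  by apply: pr_le => //; rewrite cyl_cat => x [].
have qle_v u v : q u v <= pr (cyl v).
  by rewrite -(pr_iter mT invT n (mc _ v)); apply: pr_le => //; rewrite cyl_cat => x [].
have key u v : phiE (q u v) <= - (q u v * ln (pr (cyl u))) +
    - (q u v * ln (pr (cyl v))) + (pr (cyl u) * pr (cyl v) - q u v).
  have [qz|] := eqVneq (q u v) 0.
    rewrite qz phiEE !mul0r !oppr0 !addr0 !add0r.
    by rewrite mulr_ge0// pr_ge0.
  rewrite neq_lt ltNge q0/= => qp.
  have pu := lt_le_trans qp (qle_u u v); have pv := lt_le_trans qp (qle_v u v).
  have := phiE_gibbs (q0 u v) (mulr_gt0 pu pv) ltr01.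
  rewrite ln1 mulr0 add0r divr1 lnM ?posrE//; lra.
have h1 : \sum_u \sum_v (- (q u v * ln (pr (cyl u)))) = entropy n.
  apply: eq_bigr => u _; rewrite sumrN -mulr_suml qu.
  by rewrite phiEE.
have h2 : \sum_u \sum_v (- (q u v * ln (pr (cyl v)))) = entropy p.
  rewrite exchange_big; apply: eq_bigr => u _; rewrite sumrN -mulr_suml qv.
  by rewrite phiEE.
have h3 : \sum_u \sum_v (pr (cyl u) * pr (cyl v) - q u v) = 0.
  rewrite (eq_bigr (fun=> 0)) ?big1// => u _.
  by rewrite sumrB qu -mulr_sumr sum_pr_cyl1 mulr1 subrr.
rewrite [leLHS]/entropy sum_ffun_cat.
apply: (@le_trans _ _ (\sum_u \sum_v (- (q u v * ln (pr (cyl u))) +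
    - (q u v * ln (pr (cyl v))) + (pr (cyl u) * pr (cyl v) - q u v)))).
  by apply: ler_sum => u _; apply: ler_sum => v _; exact: key.
rewrite -h1 -h2 -[leRHS]addr0 -[X in _ <= _ + X]h3 -!big_split/=.
by under [leRHS]eq_bigr do rewrite -!big_split/=.
Qed.

Definition entropy_rate : R := limn (fun n : nat => n%:R^-1 * entropy n).

Lemma entropy_rate_cvg : n%:R^-1 * entropy n @[n --> \oo] --> entropy_rate.
Proof.
have h := fekete entropy_ge0 entropy0 entropyD.
by rewrite /entropy_rate (cvg_lim _ h).
Qed.

Lemma entropy_rate_le k : (0 < k)%N -> entropy_rate <= k%:R^-1 * entropy k.
Proof.
move=> k0; have h := fekete entropy_ge0 entropy0 entropyD.
rewrite /entropy_rate (cvg_lim _ h)//; apply: ge_inf; last by exists k.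
by exists 0 => _ [j _ <-]; rewrite mulr_ge0 ?entropy_ge0// invr_ge0.
Qed.

(* Splitting each cylinder along [E] and grouping the cylinders meeting [E]
   according to the sets [D c], Gibbs' inequality compares the entropy plus the
   mean of [F] with the partition function [V]; the Hamming bound controls the
   number of cylinders in each group. *)
Lemma entropy_cover_raw (I : eqType) n (E : set S) (F : S -> R) (cs : seq I)
    (D : I -> set S) (v : I -> R) (V C b r : R) :
  measurable E -> bmeas F -> (forall x, F x <= C) ->
  (forall x, E x -> exists2 c, c \in cs & D c x) ->
  (forall c x, c \in cs -> E x -> D c x -> F x <= ln (v c)) ->
  (forall c, c \in cs -> 0 < v c) ->
  \sum_(c <- cs) v c <= V -> 0 < V -> 0 < b <= 1 ->
  (forall c x y (u w : {ffun 'I_n -> 'I_m}), c \in cs -> E x -> E y ->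
    D c x -> D c y -> cyl u x -> cyl w y -> (hamming w u)%:R <= r * n%:R) ->
  entropy n + \int[mu]_x F x <=
    pr E * (ln V + n%:R * (m%:R * b + r * - ln b)) +
    (1 - pr E) * (n%:R * ln m%:R + C) + 2.
Proof.
move=> mE bF FC cE Fv v0 sV V0 b01 hr.
pose W := {ffun 'I_n -> 'I_m}.
have mc (w : W) := measurable_cyl w.
have mCE := measurableC mE.
have mw1 (w : W) : measurable (cyl w `&` E) by exact: measurableI.
have mw2 (w : W) : measurable (cyl w `&` ~` E) by exact: measurableI.
pose p1 (w : W) := pr (cyl w `&` E); pose p2 (w : W) := pr (cyl w `&` ~` E).
have p10 w : 0 <= p1 w by exact: pr_ge0.
have p20 w : 0 <= p2 w by exact: pr_ge0.
have pE w : pr (cyl w) = p1 w + p2 w.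
  apply/le_anti/andP; split.
    apply: pr_leU => // x wx.
    by have [xE|xE] := pselect (E x); [left|right].
  rewrite -[leRHS]int_indic// /p1 /p2 -!int_indic// -int_D; try exact: bmeas_indic.
  apply: int_le; [by apply: bmeasD; exact: bmeas_indic|exact: bmeas_indic|].
  move=> x; rewrite !indicE !in_setI in_setC.
  by case: (x \in cyl w); case: (x \in E); rewrite /= ?addr0 ?add0r.
have m0 : (0 < m)%N by exact: (partition_gt0 point).
have mR : (0 : R) < m%:R by rewrite ltr0n.
have Hle : entropy n <= \sum_w phiE (p1 w) + \sum_w phiE (p2 w).
  by rewrite -big_split/=; apply: ler_sum => w _; rewrite pE phiE_leD.
(* Off [E] nothing is known about names, so the comparison is with the uniform weights on all
   words. *)
have H2 : \sum_w phiE (p2 w) <= (1 - pr E) * (n%:R * ln m%:R) + 1.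
  rewrite -pr_setC// -(sum_pr_cyl n mCE) mulr_suml.
  rewrite -[X in _ <= _ + X](sum_uniform n) -big_split/=; apply: ler_sum => w _.
  have := phiE_gibbs (p20 w) (ltr01) (exprn_gt0 n mR).
  rewrite ln1 mulr0 addr0 lnXn// -[ln _ *+ n]mulr_natl mul1r /p2 -/(p2 w).
  by have := p20 w; rewrite /p2; lra.
(* A cylinder is weighted by all codes occurring in it. Exchanging the sums, each code is counted
   once per cylinder where it occurs, and these cylinders form a family of small Hamming
   diameter. *)
pose occ (c : I) (w : W) := `[< exists x, [/\ cyl w x, E x & D c x] >].
pose Vw (w : W) := \sum_(c <- cs | occ c w) v c.
pose Z := V * expR (n%:R * (m%:R * b + r * - ln b)).
have Z0 : 0 < Z by rewrite mulr_gt0// expR_gt0.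
have lnZ : ln Z = ln V + n%:R * (m%:R * b + r * - ln b).
  by rewrite lnM ?posrE ?expR_gt0// expRK.
have Vw0 w : 0 <= Vw w.
  by rewrite /Vw big_seq_cond; apply: sumr_ge0 => c /andP[/v0/ltW].
have sVw : \sum_w Vw w <= Z.
  rewrite /Vw; under eq_bigr do rewrite big_mkcond/=.
  rewrite exchange_big/= /Z.
  apply: (@le_trans _ _ (\sum_(c <- cs) v c * expR (n%:R * (m%:R * b + r * - ln b)))).
    rewrite big_seq [leRHS]big_seq; apply: ler_sum => c ccs.
    rewrite -big_mkcond/= sumr_const -[leLHS]mulr_natr (ler_wpM2l (ltW (v0 _ ccs)))//.
    apply: (@le_trans _ _ #|[set w | occ c w]%SET|%:R).
      by rewrite cardsE.
    apply: hamming_diam => // u w; rewrite !inE.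
    move=> /asboolP[x [ux Ex Dx]] /asboolP[y [wy Ey Dy]].
    exact: (hr c x y).
  by rewrite -mulr_suml ler_wpM2r// expR_ge0.
have Vwpos w x : cyl w x -> E x -> exists2 c, c \in cs & occ c w /\ D c x.
  move=> wx Ex; have [c ccs Dc] := cE x Ex; exists c => //; split => //.
  by apply/asboolP; exists x.
have Vwge w c : c \in cs -> occ c w -> v c <= Vw w.
  move=> ccs oc; rewrite /Vw (big_rem c)//= oc lerDl.
  rewrite big_seq_cond; apply: sumr_ge0 => c' /andP[/mem_rem/v0/ltW//].
have H1 : \sum_w (phiE (p1 w) + p1 w * ln (Vw w)) <= pr E * ln Z + 1.
  have -> : pr E * ln Z = \sum_w p1 w * ln Z by rewrite -mulr_suml sum_pr_cyl.
  apply: (@le_trans _ _ (\sum_w (p1 w * ln Z + Vw w / Z))).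
    (* A cylinder of weight zero contains no point of [E], so the default value of [ln 0] is
       multiplied by zero. *)
    apply: ler_sum => w _; have [Vz|] := eqVneq (Vw w) 0.
      have -> : p1 w = 0.
        rewrite /p1 (_ : _ `&` _ = set0) ?/pr ?measure0// -subset0 => x [wx Ex].
        have [c ccs [oc _]] := Vwpos _ _ wx Ex.
        by have := Vwge _ _ ccs oc; rewrite Vz leNgt v0.
      by rewrite phiEE !mul0r oppr0 !add0r Vz mul0r.
    rewrite neq_lt ltNge Vw0/= => Vp.
    by have := phiE_gibbs (p10 w) Vp Z0; have := p10 w; lra.
  by rewrite big_split/= lerD2l -mulr_suml ler_pdivrMr// mul1r.
(* On a cylinder inside [E], [F] is bounded by the logarithm of the weight of a single code, hence
   of the whole weight [Vw w]; outside [E] only the bound [C] is available. *)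
have HF : \int[mu]_x F x <= \sum_w p1 w * ln (Vw w) + (1 - pr E) * C.
  apply: (@le_trans _ _ (\int[mu]_x (\sum_w ln (Vw w) * \1_(cyl w `&` E) x
     + C * \1_(~` E) x))); last first.
    rewrite int_D; [|by apply: bmeas_sum => w; apply: bmeasZ; exact: bmeas_indic
                    |by apply: bmeasZ; exact: bmeas_indic].
    rewrite int_sum => [|w]; last by apply: bmeasZ; exact: bmeas_indic.
    rewrite int_Z; last exact: bmeas_indic.
    rewrite int_indic// pr_setC// mulrC lerD2r; apply: ler_sum => w _.
    by rewrite int_Z ?int_indic// 1?mulrC//; exact: bmeas_indic.
  apply: int_le => //.
    apply: bmeasD; last by apply: bmeasZ; exact: bmeas_indic.
    by apply: bmeas_sum => w; apply: bmeasZ; exact: bmeas_indic.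
  move=> x; have [w wx] := cyl_ex n x.
  rewrite (bigD1 w)//= big1 => [|u uw]; last first.
    rewrite indicE memNset ?mulr0// => -[ux _].
    by move/eqP : uw; apply; exact: cyl_inj ux wx.
  rewrite addr0 !indicE in_setI in_setC (mem_set wx)/=.
  have [Ex|Ex] := pselect (E x).
    rewrite (mem_set Ex)/= mulr1 mulr0 addr0.
    have [c ccs [oc Dx]] := Vwpos _ _ wx Ex.
    rewrite (le_trans (Fv c x ccs Ex Dx))// ler_ln ?posrE ?v0 ?Vwge//.
    by rewrite (lt_le_trans (v0 _ ccs))// Vwge.
  by rewrite (memNset Ex)/= mulr0 mulr1 add0r.
rewrite -lnZ; rewrite big_split/= in H1; lra.
Qed.

Lemma entropy_le n : entropy n <= n%:R * ln m%:R.
Proof.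
have m0 : (0 < m)%N by exact: (partition_gt0 point).
have mR : (0 : R) < m%:R by rewrite ltr0n.
have -> : n%:R * ln m%:R = \sum_(w : {ffun 'I_n -> 'I_m})
    (pr (cyl w) * (n%:R * ln m%:R) + (m%:R ^+ n)^-1 - pr (cyl w)).
  rewrite sumrB big_split/= -mulr_suml.
  by rewrite sum_pr_cyl1 sum_uniform mul1r addrK.
apply: ler_sum => w _.
have := phiE_gibbs (pr_ge0 mu (cyl w)) (ltr01) (exprn_gt0 n mR).
by rewrite ln1 mulr0 addr0 lnXn// -[ln _ *+ n]mulr_natl mul1r.
Qed.

(** The raw estimate contains [pr E * ln V] and the cost of the complement of [E]. Both are
    corrected to [ln V] at a price linear in [n] with small slope, because entropy plus mean lies
    between [- n K] and [n K]; the lower bound [F0] on the mean is needed for this. The resulting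
    [t] depends neither on [n] nor on the cover. *)
Lemma entropy_cover (C F0 eta : R) : 0 <= C -> 0 < eta -> exists2 t : R, 0 < t < 1 &
  forall (I : eqType) n (E : set S) (F : S -> R) (cs : seq I)
    (D : I -> set S) (v : I -> R) (V : R),
  measurable E -> 1 - t <= pr E ->
  bmeas F -> (forall x, F x <= n%:R * C) -> n%:R * F0 <= \int[mu]_x F x ->
  (forall x, E x -> exists2 c, c \in cs & D c x) ->
  (forall c x, c \in cs -> E x -> D c x -> F x <= ln (v c)) ->
  (forall c, c \in cs -> 0 < v c) ->
  \sum_(c <- cs) v c <= V -> 0 < V ->
  (forall c x y (u w : {ffun 'I_n -> 'I_m}), c \in cs -> E x -> E y ->
    D c x -> D c y -> cyl u x -> cyl w y -> (hamming w u)%:R <= t * n%:R) ->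
  entropy n + \int[mu]_x F x <= ln V + n%:R * eta + 4.
Proof.
move=> C0 eta0; pose L : R := ln m%:R; pose K := L + C + `|F0|.
have m0 : (0 < m)%N by exact: (partition_gt0 point).
have mR : (0 : R) < m%:R by rewrite ltr0n.
have L0 : 0 <= L by rewrite ln_ge0// ler1n.
have K0 : 0 <= K by rewrite !addr_ge0.
(* The alphabet size dictates [b]; only then is [t] chosen, small against [- ln b] and against the
   slopes of the a priori bounds, all collected in [Q]. *)
pose b := Num.min 1 (eta / (3 * m%:R)).
have b0 : 0 < b by rewrite lt_min ltr01/= divr_gt0 ?mulr_gt0.
have b1 : b <= 1 by rewrite ge_min lexx.
have mb : m%:R * b <= eta / 3.
  rewrite -ler_pdivlMl// mulrC -mulrA -invfM ge_min; apply/orP; right.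
  by rewrite lexx.
have lb : 0 <= - ln b by rewrite oppr_ge0 ln_le0.
pose Q := - ln b + 2 * K + 2 * (L + C) + 1.
have Q0 : 0 < Q by rewrite /Q; lra.
pose t := Num.min (1 / 2) (eta / (3 * Q)).
have t0 : 0 < t by rewrite lt_min divr_gt0//= divr_gt0// mulr_gt0.
have th : t <= 1 / 2 by rewrite ge_min lexx.
have tQ : t * Q <= eta / 3.
  rewrite -ler_pdivlMr// -mulrA -invfM ge_min; apply/orP; right.
  by rewrite lexx.
exists t => [|I n E F cs D v V mE tE bF FC iF cE Fv v0 sV V0 hr].
  by rewrite t0 (le_lt_trans th)//; lra.
have b01 : 0 < b <= 1 by rewrite b0.
have h := entropy_cover_raw mE bF FC cE Fv v0 sV V0 b01 hr.
rewrite -/L in h.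
have nR : (0 : R) <= n%:R by [].
have E1 : pr E <= 1 by exact: pr_le1.
have X1 : entropy n + \int[mu]_x F x <= n%:R * K.
  have : \int[mu]_x F x <= n%:R * C.
    by rewrite -[leRHS](int_cst mu); apply: int_le => //; exact: bmeas_cst.
  have := entropy_le n; rewrite -/L /K; have := normr_ge0 F0.
  by move=> ? ? ?; nra.
have X0 : - (n%:R * K) <= entropy n + \int[mu]_x F x.
  have := entropy_ge0 n; have : - `|F0| <= F0 by rewrite lerNl -normrN ler_norm.
  rewrite /K => ? ?; nra.
set X := entropy n + _ in h X0 X1 *.
set th' := 1 - pr E in h.
have th0 : 0 <= th' by rewrite /th'; lra.
have tht : th' <= t by rewrite /th'; lra.
have prEE : pr E = 1 - th' by rewrite /th'; lra.
rewrite prEE in h.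
set Z := ln V + _ in h.
have ZV : Z = ln V + n%:R * (m%:R * b + t * - ln b) by [].
(* Replacing [(1 - th') * Z] by [Z] costs [th' * (- Z)]. If [Z] were very negative, [h] would push
   [X] below its lower bound [X0], so [- Z] is at most linear in [n]. *)
have key : X <= Z + 2 * th' * (n%:R * K) + 2 * th' * (n%:R * L + n%:R * C) + 4.
  set B := n%:R * L + n%:R * C in h *.
  have B0 : 0 <= B by rewrite addr_ge0// mulr_ge0.
  set Kn := n%:R * K in X0 X1 *.
  have Kn0 : 0 <= Kn by rewrite mulr_ge0.
  have [XZ|ZX] := leP X Z.
    have : 0 <= th' * Kn by rewrite mulr_ge0.
    have : 0 <= th' * B by rewrite mulr_ge0.
    by lra.
  have hZ : - Z <= 2 * (Kn + B + 2).
    rewrite leNgt; apply/negP => hz.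
    have : (1 - th') * Z <= (1/2) * Z.
      have : Z <= 0 by lra.
      by nra.
    have : th' * B <= B by nra.
    by lra.
  have : th' * (- Z) <= th' * (2 * (Kn + B + 2)) by rewrite ler_wpM2l.
  have : th' * B <= (1/2) * B by rewrite ler_wpM2r//; lra.
  have : th' * (th' * B) <= (1/2) * (th' * B).
    by rewrite ler_wpM2r ?mulr_ge0//; lra.
  have : 0 <= th' * B by rewrite mulr_ge0.
  by nra.
apply: (le_trans key); rewrite ZV.
suff : n%:R * (m%:R * b + t * - ln b + th' * (2 * K + 2 * (L + C))) <= n%:R * eta.
  by lra.
rewrite ler_wpM2l//.
have : th' * (2 * K + 2 * (L + C)) <= t * (2 * K + 2 * (L + C)).
  by rewrite ler_wpM2r//; lra.
rewrite /Q in tQ; nra.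
Qed.

End partition_entropy.

(** * Limits and Borel sets of a metric space *)

Section limits.
Context {R : realType}.
Local Open Scope ereal_scope.

Lemma limf_einf_ge (f : R -> \bar R) (a : \bar R) (e0 : R) : (0 < e0)%R ->
  (forall e : R, (0 < e)%R -> (e < e0)%R -> a <= f e) -> a <= limf_einf f 0^'+.
Proof.
move=> e00 h; rewrite limf_einfE.
apply: (@le_trans _ _ (ereal_inf [set f x | x in [set e | (0 < e < e0)%R]])).
  by apply: le_ereal_inf_tmp => _ [e /andP[? ?] <-]; exact: h.
apply: ereal_sup_ubound; exists [set e | (0 < e < e0)%R] => //.
near=> e; apply/andP; split; near: e; first exact: nbhs_right_gt.
exact: nbhs_right_lt.
Unshelve. all: by end_near.
Qed.

Lemma limf_einf_le (f : R -> \bar R) (a : \bar R) (e0 : R) : (0 < e0)%R ->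
  (forall e : R, (0 < e)%R -> (e < e0)%R -> f e <= a) -> limf_einf f 0^'+ <= a.
Proof.
move=> e00 h; rewrite limf_einfE; apply: ge_ereal_sup => _ [V V0 <-].
have [e [Ve /andP[e1 e2]]] : exists e, V e /\ (0 < e < e0)%R.
  suff /filter_ex : \forall e \near 0^'+, V e /\ (0 < e < e0)%R by [].
  near=> e; split; first by near: e.
  apply/andP; split; near: e; first exact: nbhs_right_gt.
  exact: nbhs_right_lt.
by apply: le_trans (h _ e1 e2); apply: ereal_inf_lbound; exists e.
Unshelve. all: by end_near.
Qed.

Lemma limn_einf_ge (u : (\bar R)^nat) (a : \bar R) (N : nat) :
  (forall n, (N <= n)%N -> a <= u n) -> a <= limn_einf u.
Proof.
move=> h; rewrite /limn_einf /limn_esup -/(limf_einf u \oo) limf_einfE.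
apply: (@le_trans _ _ (ereal_inf [set u x | x in [set n | (N <= n)%N]])).
  by apply: le_ereal_inf_tmp => _ [n /= ? <-]; exact: h.
by apply: ereal_sup_ubound; exists [set n | (N <= n)%N] => //; exists N.
Qed.

Lemma limn_esup_le (u : (\bar R)^nat) (a : \bar R) (N : nat) :
  (forall n, (N <= n)%N -> u n <= a) -> limn_esup u <= a.
Proof.
move=> h; apply: (@le_trans _ _ (ereal_sup [set u x | x in [set n | (N <= n)%N]])).
  by apply: ereal_inf_lbound; exists [set n | (N <= n)%N] => //; exists N.
by apply: ge_ereal_sup => _ [n /= ? <-]; exact: h.
Qed.

Section monotone.
Variable g : R -> \bar R.
Hypothesis ndg : forall a b : R, (0 < a)%R -> (a <= b)%R -> g b <= g a.

Lemma monotone_right_cvg : cvg (g x @[x --> 0^'+]).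
Proof.
apply: nonincreasing_at_right_is_cvge; near=> e => a b.
by rewrite !in_itv/= => /andP[a0 _] _; exact: ndg.
Unshelve. all: by end_near.
Qed.

Lemma monotone_right_ge (a : \bar R) (d0 : R) : (0 < d0)%R ->
  (forall x : R, (0 < x)%R -> (x < d0)%R -> a <= g x) -> a <= lim (g x @[x --> 0^'+]).
Proof.
move=> d00 h; apply: lime_ge; first exact: monotone_right_cvg.
by near=> x; apply: h; near: x; [exact: nbhs_right_gt|exact: nbhs_right_lt].
Unshelve. all: by end_near.
Qed.

Lemma monotone_right_le (a : \bar R) (d0 : R) : (0 < d0)%R ->
  (forall x : R, (0 < x)%R -> (x < d0)%R -> g x <= a) -> lim (g x @[x --> 0^'+]) <= a.
Proof.
move=> d00 h; apply: lime_le; first exact: monotone_right_cvg.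
by near=> x; apply: h; near: x; [exact: nbhs_right_gt|exact: nbhs_right_lt].
Unshelve. all: by end_near.
Qed.

End monotone.
End limits.

Section metric_borel.
Context {R : realType} {X : metricType R} {x0 : X}.
Local Notation BX := (@borelX R X x0).

Lemma open_meas (A : set X) : open A -> measurable (A : set BX).
Proof. exact: sub_sigma_algebra. Qed.

Lemma open_mball (x : X) (r : R) : open [set y | mdist x y < r].
Proof.
rewrite openE => y /= yr; apply/metricType_numDomainType.nbhs_mdistP.
exists (r - mdist x y); first by rewrite /= subr_gt0.
move=> z /= yz; rewrite (le_lt_trans (metric_triangle x y z))//.
by rewrite -ltrBrDl.
Qed.

Lemma open_mball_sym (x : X) (r : R) : open [set y | mdist y x < r].
Proof.
rewrite (_ : [set _ | _] = [set y | mdist x y < r]); first exact: open_mball.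
by apply/seteqP; split => y /=; rewrite metric_sym.
Qed.

Lemma continuous_meas (T : X -> X) : continuous T ->
  measurable_fun setT (T : BX -> BX).
Proof.
move=> /continuousP cT; apply: (@measurability _ _ BX BX setT T open) => //.
by move=> _ [A oA <-]; rewrite setTI; apply: open_meas; exact: cT.
Qed.

Lemma continuous_bmeas (mu : probability BX R) (g : X -> R) : compact [set: X] ->
  continuous g -> bmeas (g : BX -> R).
Proof.
move=> cX cg; split.
  apply: (measurability _ (RGenOInfty.measurableE R)) => _ [_ [a ->] <-].
  rewrite setTI; apply: open_meas; move/continuousP : cg; apply.
  by rewrite set_itvE; exact: open_gt.
have : compact (g @` setT) by apply: continuous_compact => //; exact: continuous_subspaceT.
move=> /compact_bounded [M [_ gM]]; exists (M + 1) => x.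
by apply: (gM (M + 1)); [rewrite ltrDl|exists x].
Qed.

Lemma continuous_iter (T : X -> X) n : continuous T -> continuous (iter n T).
Proof.
move=> cT; elim: n => [|n IH] x; first exact: cvg_id.
exact: (continuous_comp (IH x) (cT _)).
Qed.

Lemma open_bowen (T : X -> X) n x (e : R) : continuous T -> open (bowen T n x e).
Proof.
move=> cT; elim: n => [|n IH].
  by rewrite (_ : bowen T 0 x e = setT); [exact: openT|apply/seteqP; split].
rewrite (_ : bowen T n.+1 x e =
    bowen T n x e `&` iter n T @^-1` [set y | mdist (iter n T x) y < e]).
  apply: openI => //; have /continuousP := continuous_iter (n := n) cT.
  by apply; exact: open_mball.
apply/seteqP; split => y.
  by move=> h; split => [i ni|]; apply: h => //; rewrite ltnS ltnW.
by move=> [h hn] i; rewrite ltnS leq_eqVlt => /predU1P[->//|]; exact: h.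
Qed.

Lemma bowen_self (T : X -> X) n x (e : R) : 0 < e -> bowen T n x e x.
Proof. by move=> e0 i _; rewrite mdistxx. Qed.

(** * Separating the parts of a partition up to small measure *)

Section separation.
Variable mu : probability BX R.
Local Notation pr := (pr mu).

Definition close_on (A : set X) (G : set X) (e : R) : Prop :=
  forall p q, G p -> G q -> mdist p q < e -> A p -> A q.

(* Measurable sets are, up to a set of small measure, unions of pieces lying at
   positive distance from their complement; this replaces inner regularity. *)
Definition almost_clopen (A : set BX) : Prop :=
  measurable A /\ forall k : R, 0 < k -> exists e : R, exists G : set BX,
    [/\ 0 < e, measurable G, 1 - k <= pr G & close_on A G e].

(** The points whose ball of radius [r n] stays in [A] increase to [A] because [A] is open. Removing
    the thin layer [A] minus [V n] leaves the required set [G]. *)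
Lemma almost_clopen_open (A : set X) : open A -> almost_clopen A.
Proof.
move=> oA; have mA := open_meas oA; split=> // k k0.
pose r (n : nat) : R := n.+1%:R^-1.
pose V n : set BX := [set x : X | forall y, mdist x y < r n -> A y].
have VC n : V n = ~` [set x : X | exists2 y, ~ A y & mdist x y < r n].
  apply/seteqP; split => x.
    by move=> h [y Ay xy]; apply: Ay; exact: h.
  move=> h y xy; apply: contrapT => Ay; apply: h; by exists y.
have mV n : measurable (V n).
  rewrite VC; apply: measurableC; apply: open_meas.
  rewrite (_ : [set _ | _] = \bigcup_(y in ~` A) [set x | mdist x y < r n]).
    by apply: bigcup_open => y _; exact: open_mball_sym.
  by apply/seteqP; split => x [y ? ?]; exists y.
have ndV : nondecreasing_seq V.
  move=> n m nm; apply/subsetPset => x h y xy; apply: h.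
  by rewrite (lt_le_trans xy)// lef_pV2 ?posrE// ler_nat ltnS.
have VA : \bigcup_n V n = A.
  apply/seteqP; split => x.
    by move=> [n _ h]; apply: h; rewrite mdistxx invr_gt0.
  move=> Ax; have := open_nbhs_nbhs (conj oA Ax).
  move=> /metricType_numDomainType.nbhs_mdistP[e /= e0 h].
  have [n _ ne] := near_infty_natSinv_lt (PosNum e0).
  exists n => // y xy; apply: h => /=; apply: lt_le_trans xy _.
  by apply/ltW; exact: (ne n (leqnn _)).
have [n] := pr_bigcup_approx mu mV ndV k0; rewrite VA => Vn.
exists (r n), (V n `|` ~` A); split.
- by rewrite invr_gt0.
- by apply: measurableU => //; exact: measurableC.
- have : pr setT <= pr (V n `|` ~` A) + pr (A `\` V n).
    apply: pr_leU => //; [|exact: measurableD|].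
      by apply: measurableU => //; exact: measurableC.
    move=> x _; have [?|?] := pselect (V n x); first by left; left.
    by have [?|?] := pselect (A x); [right|left; right].
  have : pr (A `\` V n) = pr A - pr (V n).
    by apply: pr_setD => //; rewrite -VA => x; exists n.
  rewrite pr_setT; lra.
- by move=> p q [Vp|//] _ pq _; exact: Vp.
Qed.

Lemma almost_clopenU (A B : set BX) : almost_clopen A -> almost_clopen B ->
  almost_clopen (A `|` B).
Proof.
move=> [mA hA] [mB hB]; split; first exact: measurableU.
move=> k k0; have k20 : 0 < k / 2 by rewrite divr_gt0.
have [e [G [e0 mG pG cG]]] := hA _ k20.
have [e' [G' [e0' mG' pG' cG']]] := hB _ k20.
exists (Num.min e e'), (G `&` G'); split.
- by rewrite lt_min e0.
- exact: measurableI.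
- have : pr (~` (G `&` G')) <= pr (~` G) + pr (~` G').
    rewrite setCI; apply: pr_leU => //; try exact: measurableC.
    by apply: measurableU; exact: measurableC.
  rewrite !pr_setC//; last exact: measurableI.
  lra.
- move=> p q [Gp Gp'] [Gq Gq']; rewrite lt_min => /andP[pq pq'] [Ap|Bp].
    by left; exact: (cG p).
  by right; exact: (cG' p).
Qed.

Lemma almost_clopenC (A : set BX) : almost_clopen A -> almost_clopen (~` A).
Proof.
move=> [mA hA]; split; first exact: measurableC.
move=> k /hA[e [G [e0 mG pG cG]]]; exists e, G; split => // p q Gp Gq pq Ap Aq.
by apply: Ap; apply: (cG q) => //; rewrite metric_sym.
Qed.

(** A countable union differs from a finite one by a set of small measure, which is removed from
    [G]. With complements this makes the almost clopen sets a sigma-algebra containing the open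
    sets. *)
Lemma almost_clopen_bigcup (A : (set BX)^nat) : (forall n, almost_clopen (A n)) ->
  almost_clopen (\bigcup_n A n).
Proof.
move=> hA; have mA n : measurable (A n) by case: (hA n).
have mUA : measurable (\bigcup_n A n) by exact: bigcup_measurable.
pose U n := \big[setU/set0]_(i < n) A i.
have hU n : almost_clopen (U n).
  elim: n => [|n IH]; first by rewrite /U big_ord0; apply: almost_clopen_open; exact: open0.
  by rewrite /U big_ord_recr/=; exact: almost_clopenU.
have mU n : measurable (U n) by case: (hU n).
have ndU : nondecreasing_seq U.
  by move=> n m nm; apply/subsetPset; exact: subset_bigsetU.
have UA : \bigcup_n U n = \bigcup_n A n.
  apply/seteqP; split => x [n _]; rewrite /U.
    by rewrite -bigcup_mkord => -[i _ Ai]; exists i.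
  by move=> An; exists n.+1 => //; rewrite -bigcup_mkord; exists n => //=.
split=> // k k0; have k20 : 0 < k / 2 by rewrite divr_gt0.
have [n] := pr_bigcup_approx mu mU ndU k20; rewrite UA => Un.
have [_ /(_ _ k20)[e [G [e0 mG pG cG]]]] := hU n.
have UsA : U n `<=` \bigcup_n A n by rewrite -UA => x; exists n.
have mD : measurable (\bigcup_n A n `\` U n) by exact: measurableD.
exists e, (G `\` (\bigcup_n A n `\` U n)); split => //.
- exact: measurableD.
- have : pr (~` (G `\` (\bigcup_n A n `\` U n))) <=
      pr (~` G) + pr (\bigcup_n A n `\` U n).
    apply: pr_leU => //; first by apply: measurableC; exact: measurableD.
      exact: measurableC.
    move=> x /= h; have [Gx|] := pselect (G x); last by left.
    by right; apply: contrapT => nx; apply: h.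
  have : pr (\bigcup_n A n `\` U n) <= k / 2.
    by rewrite pr_setD//; lra.
  rewrite !pr_setC//; last exact: measurableD.
  lra.
- move=> p q [Gp nDp] [Gq _] pq Ap; apply: UsA; apply: (cG p) => //.
  by apply: contrapT => Up; apply: nDp.
Qed.

Lemma measurable_almost_clopen (A : set BX) : measurable A -> almost_clopen A.
Proof.
move: A; apply: smallest_sub; last first.
  by move=> A oA; exact: almost_clopen_open.
split.
- by apply: almost_clopen_open; exact: open0.
- by move=> A hA; rewrite setTD; exact: almost_clopenC.
- by move=> A; exact: almost_clopen_bigcup.
Qed.

Lemma separated_partition m (P : 'I_m -> set X) (k : R) :
  (forall i, measurable (P i : set BX)) -> 0 < k ->
  exists e : R, exists G : set BX, [/\ 0 < e, measurable G, 1 - k <= pr G &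
    forall i, close_on (P i) G e].
Proof.
move=> mP k0.
suff h (s : seq 'I_m) (j : R) : 0 < j -> exists e : R, exists G : set BX,
    [/\ 0 < e, measurable G, 1 - j <= pr G & forall i, i \in s -> close_on (P i) G e].
  have [e [G [e0 mG pG cG]]] := h (enum 'I_m) k k0.
  by exists e, G; split => // i; apply: cG; rewrite mem_enum.
elim: s j => [|i s IH] j j0.
  by exists 1, setT; rewrite pr_setT; split => //; lra.
have j20 : 0 < j / 2 by rewrite divr_gt0.
have [e [G [e0 mG pG cG]]] := IH _ j20.
have [_ /(_ _ j20)[e' [G' [e0' mG' pG' cG']]]] := measurable_almost_clopen (mP i).
exists (Num.min e e'), (G `&` G'); split.
- by rewrite lt_min e0.
- exact: measurableI.
- have : pr (~` (G `&` G')) <= pr (~` G) + pr (~` G').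
    rewrite setCI; apply: pr_leU => //; try exact: measurableC.
    by apply: measurableU; exact: measurableC.
  rewrite !pr_setC//; last exact: measurableI.
  lra.
- move=> l; rewrite inE => ls p q [Gp Gp'] [Gq Gq']; rewrite lt_min => /andP[pq pq'].
  case/predU1P : ls => [->|ls]; first exact: (cG' p).
  exact: (cG _ ls p).
Qed.

End separation.
End metric_borel.

(** * Lower bounds *)

(** Reduces spanning sets to finite ones: over an infinite set, terms bounded below by a positive
    constant have infinite sum, and the lower bound is then trivial. *)
Lemma esum_infinite (R : realType) (I : choiceType) (A : set I) (a : I -> R) (c : R) :
  infinite_set A -> 0 < c -> (forall x, c <= a x) ->
  (\esum_(x in A) (a x)%:E = +oo)%E.
Proof.
move=> iA c0 ca; apply/eqyP => M M0.
pose n : nat := (Num.truncn (M / c)).+1.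
have [B BA nB] := infinite_set_fset n iA.
have h : (\sum_(x \in [set` B]) (a x)%:E <= \esum_(x in A) (a x)%:E)%E.
  by apply: ereal_sup_ubound; exists [set` B] => //; split.
apply: le_trans h.
rewrite fsbig_finite//= set_fsetK sumEFin lee_fin.
apply: (@le_trans _ _ (\sum_(x <- B) c)); last exact: ler_sum.
rewrite big_const_seq count_predT iter_addr_0 -[leRHS]mulr_natl.
rewrite -ler_pdivrMr// ltW// (lt_le_trans (truncnS_gt _))//.
by rewrite ler_nat.
Qed.

Section lower_bounds.
Context {R : realType} {X : metricType R} {x0 : X}.
Local Notation BX := (@borelX R X x0).
Variables (T : X -> X) (f : nat -> X -> R) (mu : probability BX R).
Hypothesis cX : compact [set: X].
Hypothesis cT : continuous T.
Hypothesis sub_f : subadditive_potential T f.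
Hypothesis inv_mu : invariant mu T.
Variable Fs : R.
Hypothesis Fs_le : forall n, (0 < n)%N -> n%:R * Fs <= \int[mu]_x f n x.

Local Notation pr := (pr mu).
Let mT : measurable_fun setT (T : BX -> BX) := continuous_meas cT.

Lemma potential_bmeas n : (0 < n)%N -> bmeas (f n : BX -> R).
Proof. by move=> n0; apply: (continuous_bmeas mu) => //; apply: sub_f.1. Qed.

Lemma potential_le1 : exists2 C : R, 0 <= C & forall x, f 1%N x <= C.
Proof.
have [_ [M fM]] := potential_bmeas (ltn0Sn 0).
exists `|M| => // x; rewrite (le_trans (ler_norm _))// (le_trans (fM x))//.
exact: ler_norm.
Qed.

(* The hypotheses say nothing about [f 0]. *)
Definition fz n x : R := if n is 0%N then 0 else f n x.

Lemma fzE n : (0 < n)%N -> fz n = f n.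
Proof. by case: n. Qed.

Lemma fz_sub n m x : fz (n + m) x <= fz n x + fz m (iter n T x).
Proof.
case: n => [|n]; first by rewrite add0n add0r.
case: m => [|m]; first by rewrite addn0 addr0.
exact: sub_f.2.
Qed.

Lemma potential_le C n x : (forall x, f 1%N x <= C) -> (0 < n)%N ->
  f n x <= n%:R * C.
Proof.
move=> fC n0; rewrite -fzE//; elim: n {n0} x => [|n IH] x.
  by rewrite mul0r.
rewrite -addn1 (le_trans (fz_sub _ _ _))// natrD mulrDl mul1r lerD//.
exact: fC.
Qed.

Lemma le_supB n x y (e : R) : (0 < n)%N -> bowen T n x e y ->
  f n y <= supB T f n x e.
Proof.
move=> n0 xy; apply: sup_ubound; last by exists y.
have [C _ fC] := potential_le1.
by exists (n%:R * C) => _ [z _ <-]; exact: potential_le.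
Qed.

Section one_partition.
Context (m : nat) (P : 'I_m -> set X).
Hypothesis mP : forall i, measurable (P i : set BX).
Hypothesis dP : forall i j, i != j -> P i `&` P j = set0.
Hypothesis cP : forall x, exists i, P i x.

Local Notation cyl := (@cyl _ BX T m P _).
Local Notation H := (@entropy _ BX R mu T m P).

(** The product system. With it, the number of times two orbits are at distance at least [e] is a
    Birkhoff sum and splits along a code by [bsum_add]. *)
Definition map2 (p : X * X) : X * X := (T p.1, T p.2).
Definition far (e : R) (p : X * X) : R := (~~ (mdist p.1 p.2 < e))%:R.

Lemma iter_map2 n x y : iter n map2 (x, y) = (iter n T x, iter n T y).
Proof. by elim: n => [//|n IH] /=; rewrite IH. Qed.

(** If at time [i] both orbits are in [G] and closer than [e], separation puts them in the same
    part; each disagreement is therefore charged to one of three events. *)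
Lemma hamming_bsum (G : set BX) (e : R) n x y (u w : {ffun 'I_n -> 'I_m}) :
  (forall i, close_on (P i) G e) -> cyl u x -> cyl w y ->
  (hamming w u)%:R <= bsum T \1_(~` G) n x + bsum T \1_(~` G) n y +
    bsum map2 (far e) n (x, y).
Proof.
move=> cG ux wy; rewrite /hamming -sum1_card natr_sum /bsum -!big_split/=.
rewrite big_mkcond/=; apply: ler_sum => i _.
rewrite iter_map2 /far /fst /snd.
have indC z : \1_(~` G) z = (~~ `[< G z >])%:R :> R.
  rewrite indicE; case: asboolP => Gz; first by rewrite memNset.
  by rewrite mem_set.
rewrite !indC.
have nn (b1 b2 b3 : bool) : (0 : R) <= b1%:R + b2%:R + b3%:R by rewrite !addr_ge0.
case: ifPn => [|_]; last exact: nn.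
rewrite inE => wu.
have n1 (b1 b2 b3 : bool) : [|| b1, b2 | b3] -> (1 : R) <= b1%:R + b2%:R + b3%:R.
  move: b1 b2 b3 => [] [] []//= _; rewrite -!natrD ler1n//.
apply: n1; apply/negPn/negP; rewrite !negb_or !negbK => /and3P[].
move=> /asboolP Gx /asboolP Gy xy.
have := dP wu; rewrite -subset0 => /(_ (iter i T y)); apply; split; first exact: wy.
exact: (cG _ _ _ Gx Gy xy (ux i)).
Qed.

Lemma entropy_cover_metric (eta : R) : 0 < eta ->
  exists t : R, exists e : R, [/\ 0 < t < 1, 0 < e &
  forall (I : eqType) n (E : set BX) (cs : seq I) (D : I -> set X) (v : I -> R) (V : R),
  (0 < n)%N -> measurable E -> 1 - t <= pr E ->
  (forall x, E x -> exists2 c, c \in cs & D c x) ->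
  (forall c x, c \in cs -> E x -> D c x -> f n x <= ln (v c)) ->
  (forall c, c \in cs -> 0 < v c) ->
  \sum_(c <- cs) v c <= V -> 0 < V ->
  (forall c x y, c \in cs -> E x -> E y -> D c x -> D c y ->
    bsum map2 (far e) n (x, y) <= t * n%:R) ->
  H n + \int[mu]_x f n x <= ln V + n%:R * eta + 4].
Proof.
move=> eta0; have [C C0 fC] := potential_le1.
have [t /andP[t0 t1] ht] := entropy_cover mu mT mP dP cP Fs C0 eta0.
(* Three sources of disagreement, each at most [k * n], stay below [t * n], and the two exceptional
   sets of measure at most [k] stay below [t]. *)
pose k := t / 4; have k0 : 0 < k by rewrite divr_gt0.
have k1 : k < 1 by rewrite /k; lra.
(* The square is for Markov's inequality: if the complement of [G] has measure at most [k * k], more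
   than [k * n] visits to it occur with probability at most [k]. *)
have [e [G [e0 mG pG cG]]] := separated_partition mu mP (mulr_gt0 k0 k0).
exists k, e; split => //; first by rewrite k0.
move=> I n E cs D v V n0 mE pE cE fv v0 sV V0 hfar.
pose E2 : set BX := [set x : BX | bsum T \1_(~` G) n x <= k * n%:R].
have mE2 : measurable E2.
  apply: (@measurable_le_fun _ _ _); apply: bmeas_bsum => //.
  exact/bmeas_indic/measurableC.
have pE2 : 1 - k <= pr E2.
  apply: rare_visits => //; first exact: measurableC.
  by rewrite pr_setC//; lra.
have pEE : 1 - t <= pr (E `&` E2).
  have : pr (~` (E `&` E2)) <= pr (~` E) + pr (~` E2).
    rewrite setCI; apply: pr_leU => //; try exact: measurableC.
    by apply: measurableU; exact: measurableC.
  rewrite !pr_setC//; last exact: measurableI.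
  by rewrite /k in pE pE2; lra.
apply: (ht I n (E `&` E2) (f n) cs D v V) => //.
- exact: measurableI.
- exact: potential_bmeas.
- by move=> x; exact: potential_le.
- exact: Fs_le.
- by move=> x [Ex _]; exact: cE.
- by move=> c x ccs [Ex _]; exact: fv.
- move=> c x y u w ccs [Ex E2x] [Ey E2y] Dx Dy ux wy.
  have := hamming_bsum cG ux wy; have := hfar c x y ccs Ex Ey Dx Dy.
  move: E2x E2y; rewrite /E2 /k /= => h1 h2 h3 h4.
  have : (0 : R) <= t * n%:R by rewrite mulr_ge0// ltW.
  lra.
Qed.

Lemma far_bowen n x y z (e e' : R) : e' + e' <= e -> bowen T n z e' x ->
  bowen T n z e' y -> bsum map2 (far e) n (x, y) = 0.
Proof.
move=> ee zx zy; rewrite /bsum big1// => i _; rewrite iter_map2 /far/=.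
rewrite (lt_le_trans _ ee)//.
rewrite (le_lt_trans (metric_triangle _ (iter i T z) _))//.
by rewrite metric_sym ltrD//; [exact: zx|exact: zy].
Qed.

Lemma span_lower (eta : R) : 0 < eta -> exists t : R, exists e : R,
  [/\ 0 < t, 0 < e & forall n (eps delta : R), (0 < n)%N -> 0 < eps -> eps < e ->
    delta <= t ->
  ((H n + \int[mu]_x f n x - n%:R * eta - 4)%:E <=
    lne (spanPn mu T f n eps delta))%E].
Proof.
move=> eta0; have [t [e [/andP[t0 t1] e0 ht]]] := entropy_cover_metric eta0.
exists t, (e / 2); split => //; first by rewrite divr_gt0.
move=> n eps delta n0 eps0 epse dt.
set a := _ - 4.
suff : ((expR a)%:E <= spanPn mu T f n eps delta)%E.
  move=> h; rewrite -[a]expRK -lne_EFin ?expR_gt0// lee_lne//.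
    by rewrite in_itv/= leey andbT lee_fin expR_ge0.
  by rewrite in_itv/= leey andbT (le_trans _ h)// lee_fin expR_ge0.
apply: le_ereal_inf_tmp => _ [F hF <-].
set E : set BX := \bigcup_(x in F) bowen T n x eps in hF.
have mE : measurable E.
  by apply: open_meas; apply: bigcup_open => x _; exact: open_bowen.
have pE : 1 - t <= pr E.
  by rewrite -lee_fin prE// (le_trans _ hF)// lee_fin; lra.
(* An infinite spanning set has infinite sum, since each supremum is at least the value of [f n] at
   the centre. *)
have [finF|infF] := pselect (finite_set F); last first.
  have [_ [M fM]] := potential_bmeas n0.
  rewrite (esum_infinite infF (expR_gt0 (- M))) ?leey// => x.
  rewrite ler_expR (le_trans _ (le_supB n0 (@bowen_self _ _ T n x eps eps0)))//.
  by have := fM x; rewrite ler_norml => /andP[].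
rewrite esum_fset// fsbig_finite//= sumEFin lee_fin.
set V := \sum_(_ <- _) _.
have [x Ex] : E !=set0.
  apply/set0P/negP => /eqP E0; move: pE; rewrite E0 /pr measure0/=; lra.
have V0 : 0 < V.
  have [z Fz _] := Ex; rewrite /V (big_rem z)/=; last by rewrite in_fset_set// mem_set.
  by rewrite ltr_pwDl ?expR_gt0//; apply: sumr_ge0 => *; exact: expR_ge0.
rewrite -[leRHS]lnK ?posrE// ler_expR /a.
suff : H n + \int[mu]_x f n x <= ln V + n%:R * eta + 4 by lra.
apply: (ht _ n E (fset_set F) (fun x => bowen T n x eps)
  (fun x => expR (supB T f n x eps)) V) => //.
- by move=> y [z Fz zy]; exists z => //; rewrite in_fset_set// mem_set.
- by move=> z y _ _ zy; rewrite expRK le_supB.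
- by move=> *; exact: expR_gt0.
- move=> c y z _ _ _ cy cz; rewrite (far_bowen _ cy cz); last by lra.
  by rewrite mulr_ge0// ltW.
Qed.

(** * Coding orbits by the balls of a cover with varying lengths *)

Section cover_codes.
Variables (s eps : R) (J : set nat) (x : nat -> X) (l : nat -> nat) (k : nat).
Hypothesis l_gt0 : forall i, J i -> (0 < l i)%N.

(* [None] stands for a skipped time step, [Some i] for a passage through the
   [i]-th ball of the cover. *)
Definition clen (o : option nat) : nat := if o is Some i then l i else 1%N.
Definition cball (o : option nat) : set X :=
  if o is Some i then bowen T (l i) (x i) eps else setT.
(** A skip takes weight 1/2 and leaves 1/2 for the balls, which is the bound in [cover_le]; so
    Kraft's inequality applies. *)
Definition cwt (o : option nat) : R :=
  if o is Some i then expR (- (s * (l i)%:R) + supB T f (l i) (x i) eps) else 1 / 2.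
Definition cidx : seq nat := [seq i <- iota 0 k | `[< J i >]].
Definition citems : seq (option nat) := None :: map Some cidx.
Definition cunion : set X := \bigcup_(i in J `&` `I_k) bowen T (l i) (x i) eps.

Let in_cidx i : (i \in cidx) = `[< J i >] && (i < k)%N.
Proof. by rewrite mem_filter mem_iota add0n. Qed.

Lemma in_citems o : o \in citems -> if o is Some i then J i /\ (i < k)%N else True.
Proof.
rewrite inE => /predU1P[->//|/mapP[i]]; rewrite in_cidx => /andP[/asboolP Ji ik] ->.
by [].
Qed.

Lemma clen_gt0 o : o \in citems -> (0 < clen o)%N.
Proof. by move=> /in_citems; case: o => [i [Ji _]|//]; exact: l_gt0. Qed.

Lemma cwt_gt0 o : 0 < cwt o.
Proof. by case: o => [i|]; [exact: expR_gt0|rewrite divr_gt0]. Qed.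

(** Greedy parsing: use a retained ball that contains the current point and fits into the remaining
    time, otherwise skip one step. A skip happens outside [cunion], or where the available ball is
    too long; the latter occurs only when less time remains than the maximal length, hence the
    [minn] term. *)
Lemma code_ex n y : exists2 c, is_code T citems clen cball c n y &
  ((count_mem None c)%:R : R) <= bsum T \1_(~` cunion) n y +
    (minn n (\max_(i <- cidx) l i))%:R.
Proof.
set L := \max_(i <- _) _.
have ind0 z : (0 : R) <= \1_(~` cunion) z by rewrite indicE.
elim/ltn_ind: n y => -[|n] IH y.
  by exists [::] => //=; rewrite /bsum big_ord0 min0n addr0.
have [[i [ii lin yi]]|hno] :=
    pselect (exists i, [/\ i \in cidx, (l i <= n.+1)%N & cball (Some i) y]).
  have si : Some i \in citems by rewrite inE; apply/orP; right; exact: map_f.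
  have li0 := clen_gt0 si.
  have lt : (n.+1 - l i < n.+1)%N by rewrite /= in li0; lia.
  have [c hc cc] := IH _ lt (iter (l i) T y).
  exists (Some i :: c) => //=; rewrite add0n (le_trans cc)//.
  have -> : bsum T \1_(~` cunion) n.+1 y = bsum T \1_(~` cunion) (l i) y +
      bsum T \1_(~` cunion) (n.+1 - l i) (iter (l i) T y) :> R.
    by rewrite -bsum_add subnKC.
  apply: lerD.
    by rewrite lerDr; apply: sumr_ge0.
  by rewrite ler_nat; lia.
have [c hc cc] := IH n (ltnSn n) (T y).
exists (None :: c).
  by split=> //=; rewrite subn1.
rewrite /= natrD bsumS.
have [yU|yU] := pselect (cunion y); last first.
  rewrite indicE mem_set// -addrA lerD2l (le_trans cc)// lerD2l ler_nat; lia.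
have [i [Ji ik] yi] := yU.
have ii : i \in cidx by rewrite in_cidx ik andbT; exact/asboolP.
(* The point is covered, but its ball does not fit: the remaining time is below the maximal length,
   so the skip is paid by the increase of the [minn] term. *)
have lin : (n.+1 < l i)%N by rewrite ltnNge; apply/negP => ?; apply: hno; exists i.
have liL : (l i <= L)%N by rewrite /L (big_rem i)//= leq_max leqnn.
rewrite (minn_idPl _); last by lia.
rewrite (minn_idPl _) in cc; last by lia.
by rewrite -[n.+1]add1n natrD; have := ind0 y; lra.
Qed.

(** Subadditivity along the code. A ball contributes its supremum, which is its log-weight plus [s]
    times its length; a skip contributes at most [C], and the constant also makes up for its
    log-weight [- ln 2] and for a negative [s]. *)
Lemma code_potential C c n y : (forall z, f 1%N z <= C) -> is_code T citems clen cball c n y ->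
  fz n y <= ln (cweight cwt c) + s * n%:R +
    (count_mem None c)%:R * (C + `|s| + ln 2).
Proof.
move=> fC; elim: c n y => [|o c IH] n y /=.
  by move=> ->; rewrite /cweight big_nil ln1 mulr0 mul0r !addr0.
move=> [oi lon yo /IH h].
have cw0 d : 0 < cweight cwt d by apply: prodr_gt0 => *; exact: cwt_gt0.
have -> : ln (cweight cwt (o :: c)) = ln (cwt o) + ln (cweight cwt c).
  by rewrite /cweight big_cons lnM ?posrE ?cwt_gt0//; exact: cw0.
have -> : fz n y = fz (clen o + (n - clen o)) y by rewrite subnKC.
apply: (le_trans (fz_sub _ _ _)).
have nE : (n%:R : R) = (clen o)%:R + (n - clen o)%:R by rewrite -natrD subnKC.
rewrite nE natrD.
suff : fz (clen o) y <= ln (cwt o) + s * (clen o)%:R + (o == None)%:R * (C + `|s| + ln 2).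
  by move: h; set A := fz _ _; set B := fz _ _ => h1 h2; nra.
case: o {h nE} oi lon yo => [i|] oi lon yo /=.
  rewrite mul0r addr0 expRK addrAC addNr add0r fzE.
    by rewrite le_supB//; exact: (clen_gt0 oi).
  exact: (clen_gt0 oi).
rewrite !mul1r mulr1 lnV ?posrE//.
have := fC y; have : - `|s| <= s by rewrite lerNl -normrN ler_norm.
lra.
Qed.

(** During a common passage through a ball the two orbits are within [eps + eps] of each other, so
    they can be far apart only at skipped steps. *)
Lemma code_far c n y z e : eps + eps <= e ->
  is_code T citems clen cball c n y -> is_code T citems clen cball c n z ->
  bsum map2 (far e) n (y, z) <= (count_mem None c)%:R.
Proof.
move=> ee; elim: c n y z => [|o c IH] n y z /=.
  by move=> -> _; rewrite /bsum big_ord0.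
move=> [oi lon yo cy] [_ _ zo cz]; have h := IH _ _ _ cy cz.
rewrite -(subnKC lon) bsum_add iter_map2 natrD lerD//.
case: o {h cy cz} oi lon yo zo => [i|] oi lon yo zo.
  by rewrite (far_bowen ee yo zo).
by rewrite /bsum big_ord1 /far lern1 leq_b1.
Qed.

Hypothesis cover_le : (\esum_(i in J)
  (expR (- (s * (l i)%:R) + supB T f (l i) (x i) eps))%:E <= (1 / 2)%:E)%E.

Lemma cwt_sum : \sum_(o <- citems) cwt o <= 1.
Proof.
rewrite /citems big_cons big_map /=.
suff : \sum_(i <- cidx) cwt (Some i) <= 1 / 2 by lra.
rewrite -lee_fin (le_trans _ cover_le)// -sumEFin fsbig_seq; last first.
  by rewrite filter_uniq// iota_uniq.
apply: ereal_sup_ubound; exists [set` cidx] => //; split; first exact: finite_seq.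
by move=> i /=; rewrite in_cidx => /andP[/asboolP].
Qed.

End cover_codes.

(** A single cover of sum below 1/2 and lengths at least 1 generates economical codes at every large
    time [n]. The entropy estimate at time [n], divided by [n], then bounds the exponent [s]. *)
Lemma cara_lower (eta : R) : 0 < eta -> exists2 e : R, 0 < e &
  forall (Z : set X) (eps s : R), measurable (Z : set BX) -> mu Z = 1%E ->
  0 < eps -> eps < e -> (caraM T f Z s 1 eps < (1 / 2)%:E)%E ->
  entropy_rate mu T P + Fs <= s + eta.
Proof.
move=> eta0; have eta20 : 0 < eta / 4 by rewrite divr_gt0.
have [t [e [/andP[t0 t1] e0 ht]]] := entropy_cover_metric eta20.
have [C C0 fC] := potential_le1.
exists (e / 2); first by rewrite divr_gt0.
move=> Z eps s mZ Z1 eps0 epse /ereal_inf_lt[_ [J [x [l [Jl ZJ ->]]]] cJ].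
have hlt := ltW cJ.
pose K0 := C + `|s| + ln 2.
have K00 : 0 <= K0 by rewrite /K0 !addr_ge0// ln_ge0// ler1n.
(* Skips take up a fraction at most [2 * d] of the time, one [d] from leaving the retained balls and
   one from the final incomplete passage. This must respect the Hamming budget [t] and cost at most
   [eta / 4] in the potential. *)
pose d := Num.min (t / 2) (eta / (8 * (K0 + 1))).
have d0 : 0 < d by rewrite lt_min divr_gt0//= divr_gt0// mulr_gt0// ltr_wpDl.
have dt : 2 * d <= t by rewrite -ler_pdivlMl// mulrC ge_min lexx.
have dK : 2 * d * K0 <= eta / 4.
  have : d * (8 * (K0 + 1)) <= eta.
    by rewrite -ler_pdivlMr ?ge_min ?lexx ?orbT// mulr_gt0// ltr_wpDl.
  by nra.
pose U k : set BX := cunion eps J x l k.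
have mU k : measurable (U k).
  by apply: open_meas; apply: bigcup_open => i _; exact: open_bowen.
have ndU : nondecreasing_seq U.
  move=> a b ab; apply/subsetPset => y [i [Ji ia] yi]; exists i => //.
  by split => //=; exact: leq_trans ab.
(* Finitely many balls miss measure at most [d * t], so more than [d * n] visits outside them have
   probability at most [t]. *)
have [k Uk] := pr_bigcup_approx mu mU ndU (mulr_gt0 d0 t0).
have UU : 1 <= pr (\bigcup_k U k).
  have <- : pr Z = 1 by rewrite /pr Z1.
  apply: pr_le => //; first exact: bigcup_measurable.
  move=> y /ZJ [i Ji yi]; exists i.+1 => //; exists i => //.
  by split => //=.
have prU : pr (~` U k) <= d * t by rewrite pr_setC//; lra.
pose L := \max_(i <- cidx J k) l i.
have main n : (0 < n)%N -> L%:R <= d * n%:R ->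
    n%:R * (entropy_rate mu T P + Fs - s - eta / 2) <= 4.
  move=> n0 Ln.
  pose E : set BX := [set y : BX | bsum T \1_(~` U k) n y <= d * n%:R].
  have mE : measurable E.
    apply: (@measurable_le_fun _ _ _); apply: bmeas_bsum => //.
    exact/bmeas_indic/measurableC.
  have pE : 1 - t <= pr E.
    by apply: rare_visits => //; exact: measurableC.
  pose it := citems J k; pose ll := clen l; pose wt := cwt s eps x l.
  pose cs := [seq c <- codes it ll n n | (count_mem None c)%:R <= 2 * d * n%:R].
  (* The part of the bound in [code_potential] common to all retained codes. Multiplying the weights
     by it makes their logarithms dominate [f n], and by Kraft their total is at most [kap]. *)
  pose kap := expR (s * n%:R + 2 * d * n%:R * K0).
  have cw0 c : 0 < cweight wt c by apply: prodr_gt0 => *; exact: cwt_gt0.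
  have := ht _ n E cs (fun c y => is_code T it ll (cball eps x l) c n y)
    (fun c => cweight wt c * kap) kap n0 mE pE.
  have kap0 : 0 < kap by exact: expR_gt0.
  have l0 : forall o, o \in it -> (0 < ll o)%N by move=> o; exact: clen_gt0.
  move=> /(_ _ _ _ _ kap0) h.
  have {h} : H n + \int[mu]_x f n x <= ln kap + n%:R * (eta / 4) + 4.
    apply: h.
    - move=> y Ey; have [c hc cc] := code_ex eps x k Jl n y; exists c => //.
      rewrite mem_filter (is_code_mem l0 hc (leqnn _)) andbT.
      rewrite (le_trans cc)//; move: Ey; rewrite /E /U/= => Ey.
      have : (minn n L)%:R <= d * n%:R.
        by rewrite (le_trans _ Ln)// ler_nat geq_minr.
      rewrite /L; lra.
    - move=> c y; rewrite mem_filter => /andP[cc _] Ey hc.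
      rewrite -fzE// (le_trans (code_potential s Jl fC hc))//.
      rewrite lnM ?posrE// expRK -/wt -addrA lerD2l lerD2l.
      by rewrite -/K0 ler_wpM2r.
    - by move=> c _; rewrite mulr_gt0.
    - rewrite -mulr_suml (ler_piMl (ltW kap0))// /cs big_filter.
      apply: le_trans (kraft ll _ (cwt_sum k hlt) n n); last first.
        by move=> o _; exact/ltW/cwt_gt0.
      by rewrite [leRHS](bigID (fun c => (count_mem None c)%:R <= 2 * d * n%:R))/= lerDl sumr_ge0// => c _; exact: ltW.
    - move=> c y z; rewrite mem_filter => /andP[cc _] Ey Ez hy hz.
      rewrite (le_trans (code_far _ hy hz)) ?(le_trans cc)//; first lra.
      by rewrite ler_wpM2r.
  rewrite expRK => h.
  have h1 := entropy_rate_le mT inv_mu mP dP cP n0.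
  have h2 : n%:R * entropy_rate mu T P <= H n.
    by rewrite -ler_pdivlMl ?ltr0n.
  have h3 := Fs_le n0.
  have nR : (0 : R) < n%:R by rewrite ltr0n.
  have h4 : 2 * d * n%:R * K0 <= n%:R * (eta / 4).
    by rewrite mulrAC [leRHS]mulrC ler_wpM2r// ltW.
  nra.
rewrite leNgt; apply/negP => hlt2.
set a := entropy_rate mu T P + Fs - s - eta / 2 in main.
have a0 : eta / 2 < a by rewrite /a; lra.
(* Large enough for the final passage to be negligible, and for the excess [n * eta / 2] to beat the
   additive constant 4. *)
pose n := ((Num.truncn (L%:R / d)).+1 + (Num.truncn (4 / (eta / 2))).+1)%N.
have n0 : (0 < n)%N by rewrite /n.
have nL : L%:R <= d * n%:R.
  rewrite mulrC -ler_pdivrMr// (le_trans (ltW (truncnS_gt _)))//.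
  by rewrite ler_nat leq_addr.
have na : 4 < n%:R * (eta / 2).
  rewrite -ltr_pdivrMr ?divr_gt0// (lt_le_trans (truncnS_gt _))//.
  by rewrite ler_nat leq_addl.
have := main n n0 nL; have : (0 : R) < n%:R by rewrite ltr0n.
by move=> ? ?; nra.
Qed.

End one_partition.
End lower_bounds.

(** * Upper bounds *)

Section compact_metric.
Context {R : realType} {X : metricType R} {x0 : X}.
Local Notation BX := (@borelX R X x0).
Hypothesis cX : compact [set: X].

Lemma compact_balls (r : X -> R) : (forall x, 0 < r x) ->
  exists s : seq X, forall y, exists2 x, x \in s & mdist x y < r x.
Proof.
move=> r0; pose pX : ptopologicalType := HB.pack X (isPointed.Build X x0).
have := cX; rewrite -[compact _]/(@compact pX setT) compact_cover.
move=> /(_ X setT (fun x => [set y | mdist x y < r x])) [].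
- by move=> x _; exact: open_mball.
- by move=> y _; exists y => //=; rewrite mdistxx.
by move=> D _ h; exists (enum_fset D) => y; have [x xD xy] := h y I; exists x.
Qed.

Lemma uniform_continuity (g : X -> R) (eta : R) : continuous g -> 0 < eta ->
  exists2 e : R, 0 < e & forall x y, mdist x y < e -> `|g x - g y| <= eta.
Proof.
move=> cg eta0; have eta20 : 0 < eta / 2 by rewrite divr_gt0.
have hr x : {r : R | 0 < r /\ forall y, mdist x y < r + r -> `|g x - g y| < eta / 2}.
  apply: cid; have /cvgrPdist_lt/(_ _ eta20) := cg x.
  move=> /metricType_numDomainType.nbhs_mdistP[r /= r0 hr].
  by exists (r / 2); split => [|y xy]; [rewrite divr_gt0|apply: hr => /=; rewrite [ltRHS]splitr].
have [s hs] := compact_balls (fun x => (projT2 (hr x)).1).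
suff [e e0 he] : exists2 e : R, 0 < e & forall x, x \in s -> e <= projT1 (hr x).
  exists e => // y z yz; have [x xs xy] := hs y.
  have [_ hx] := projT2 (hr x); have ex := he x xs.
  have r0 : 0 < projT1 (hr x) := (projT2 (hr x)).1.
  have h1 : `|g x - g y| < eta / 2 by apply: hx; rewrite (lt_trans xy)// ltrDl.
  have h2 : `|g x - g z| < eta / 2.
    apply: hx; rewrite (le_lt_trans (metric_triangle x y z))// ltrD//.
    exact: lt_le_trans ex.
  have -> : g y - g z = (g x - g z) - (g x - g y) by ring.
  by rewrite (le_trans (ler_normB _ _))//; lra.
elim: s {hs} => [|x s [e e0 he]]; first by exists 1.
exists (Num.min e (projT1 (hr x))).
  by rewrite lt_min e0; exact: (projT2 (hr x)).1.
move=> y; rewrite inE => /predU1P[->|/he h]; first by rewrite ge_min lexx orbT.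
by rewrite ge_min h.
Qed.

Lemma small_partition (e : R) : 0 < e -> exists m, exists P : 'I_m -> set X,
  @fin_partition R X x0 m P /\ forall i p q, P i p -> P i q -> mdist p q < e.
Proof.
move=> e0; have e20 : 0 < e / 2 by rewrite divr_gt0.
have [s hs] := compact_balls (fun=> e20).
pose B (i : nat) : set X := [set y | mdist (nth x0 s i) y < e / 2].
exists (size s), (fun i : 'I_(size s) => seqDU B i); split; last first.
  move=> i p q; rewrite /seqDU /B => -[/= ip _] [/= iq _].
  rewrite (le_lt_trans (metric_triangle p (nth x0 s i) q))//.
  by rewrite metric_sym [ltRHS]splitr ltrD.
have mB i : measurable (B i : set BX) by apply: open_meas; exact: open_mball.
split; [|split].
- move=> i; apply: measurableD => //; exact: bigsetU_measurable.
- move=> i j ij; have /trivIsetP/(_ i j Logic.I Logic.I) := trivIset_seqDU B.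
  by apply; rewrite (inj_eq val_inj).
- move=> y; have [x xs xy] := hs y.
  have : (\bigcup_k seqDU B k) y.
    rewrite -seqDU_bigcup_eq; exists (index x s) => //.
    by rewrite /B/= nth_index.
  move=> [k _ ky].
  have ks : (k < size s)%N.
    rewrite ltnNge; apply/negP => sk; case: ky => _; apply.
    rewrite -bigcup_mkord; exists (index x s) => /=.
      by rewrite (leq_trans _ sk)// index_mem.
    by rewrite /B/= nth_index.
  by exists (Ordinal ks).
Qed.

End compact_metric.

Section upper_bounds.
Context {R : realType} {X : metricType R} {x0 : X}.
Local Notation BX := (@borelX R X x0).
Variables (T : X -> X) (f : nat -> X -> R) (mu : probability BX R).
Hypothesis cX : compact [set: X].
Hypothesis cT : continuous T.
Hypothesis sub_f : subadditive_potential T f.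
Hypothesis erg_mu : ergodic mu T.

Local Notation pr := (pr mu).
Let mT : measurable_fun setT (T : BX -> BX) := continuous_meas cT.
Let inv_mu : invariant mu T := erg_mu.1.

(** Averaging over phases bounds [f n y] by the Birkhoff sum of [f k] at [y]. Moving to the centre
    [x] changes each of the [n] terms by at most [k * eta], and the factor [k^-1] turns this into
    [n * eta]. *)
Lemma supB_avg k (eta : R) : (0 < k)%N -> 0 < eta -> exists D : R, exists2 e : R, 0 < e &
  forall n x (eps : R), (k <= n)%N -> 0 < eps -> eps < e ->
    supB T f n x eps <= k%:R^-1 * bsum T (f k) n x + n%:R * eta + D.
Proof.
move=> k0 eta0; have [C C0 fC] := potential_le1 mu cX sub_f.
have kR : (0 : R) < k%:R by rewrite ltr0n.
have [_ [M fM]] := potential_bmeas mu cX sub_f k0.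
have [e e0 he] := uniform_continuity (x0 := x0) cX (sub_f.1 k k0) (mulr_gt0 kR eta0).
exists (2 * k%:R * C + 2 * `|M|), e => // n x eps kn eps0 epse.
apply: sup_le_ub; first by exists (f n x), x => //; exact: bowen_self.
move=> _ [y xy <-].
have n0 : (0 < n)%N by exact: leq_trans kn.
have := @subadd_avg R X T (fun n x r => fz f n x <= r) C `|M| k (f k) k0 C0
  (normr_ge0 M) _ _ fC _ _ _ n y kn.
rewrite (fzE _ n0) => h; apply: (le_trans (h _ _ _ _ _)) => {h}.
- move=> z; have := fM z; rewrite ler_norml => /andP[h _].
  by rewrite (le_trans _ h)// lerN2 ler_norm.
- by [].
- by move=> z; rewrite fzE.
- move=> a b z u v hu hv; rewrite (le_trans (fz_sub sub_f _ _ _))//.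
  exact: lerD.
- by move=> a z u v /le_trans h ?; exact: h.
rewrite addrA !lerD2r.
have : bsum T (f k) n y <= bsum T (f k) n x + n%:R * (k%:R * eta).
  rewrite -[n in n%:R]card_ord mulr_natl -sumr_const -big_split/=.
  apply: ler_sum => i _; have := he _ _ (lt_trans (xy i (ltn_ord i)) epse).
  rewrite ler_norml => /andP[]; lra.
rewrite -(ler_pM2l (x := k%:R^-1)) ?invr_gt0// => /le_trans; apply.
by rewrite mulrDr lerD2l mulrCA mulKf ?gt_eqF.
Qed.

Section one_partition.
Context (m : nat) (P : 'I_m -> set X).
Hypothesis mP : forall i, measurable (P i : set BX).
Hypothesis dP : forall i j, i != j -> P i `&` P j = set0.
Hypothesis cP : forall x, exists i, P i x.

(** * Codes by blocks of length [k] and single symbols *)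

Section block_codes.
Variable k : nat.
Hypothesis k0 : (0 < k)%N.

Local Notation W := {ffun 'I_k -> 'I_m}.
Local Notation cyl := (@cyl _ BX T m P k).

Definition blen (o : W + 'I_m) : nat := if o is inl _ then k else 1%N.
Definition bset (o : W + 'I_m) : set X :=
  match o with inl w => cyl w | inr a => P a end.
(* The uniform term keeps the weights of null cylinders positive. *)
Definition bcyl (w : W) : R := (pr (cyl w) + (m%:R ^+ k)^-1) / 4.
(** The true and the uniform masses, divided by 4, give the blocks total weight 1/2; the [m] single
    symbols share the other half. *)
Definition bwt (o : W + 'I_m) : R :=
  match o with inl w => bcyl w | inr _ => (2 * m%:R)^-1 end.
Definition bitems : seq (W + 'I_m) := enum {: W + 'I_m}.
(** The information function of the [k]-th refinement, with smoothed masses; as a finite combination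
    of indicators it is bounded. *)
Definition binfo (x : X) : R := \sum_w - ln (bcyl w) * \1_(cyl w) x.

Let m0 : (0 < m)%N := @partition_gt0 _ BX m P cP x0.
Let mR : (0 : R) < m%:R. Proof. by rewrite ltr0n. Qed.

Lemma bcyl_gt0 w : 0 < bcyl w.
Proof. by rewrite divr_gt0// ltr_wpDl ?pr_ge0// invr_gt0 exprn_gt0. Qed.

Lemma bcyl_le1 w : bcyl w <= 1.
Proof.
have : pr (cyl w) <= 1 by apply: pr_le1; exact: measurable_cyl.
have : (m%:R ^+ k)^-1 <= 1 :> R by rewrite invf_le1 ?exprn_gt0// exprn_ege1// ler1n.
rewrite /bcyl; lra.
Qed.

Lemma bwt_gt0 o : 0 < bwt o.
Proof. by case: o => [w|a] /=; [exact: bcyl_gt0|rewrite invr_gt0 mulr_gt0]. Qed.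

Lemma bwt_sum : \sum_(o <- bitems) bwt o <= 1.
Proof.
rewrite /bitems big_enum/= big_sumType/= /bcyl -mulr_suml big_split/=.
rewrite (sum_pr_cyl1 mu mT mP dP cP k) (@sum_uniform _ BX R m P cP k).
rewrite sumr_const card_ord -[(2 * _)^-1 *+ _]mulr_natl invfM mulrCA divff ?gt_eqF//.
lra.
Qed.

Lemma blen_gt0 o : o \in bitems -> (0 < blen o)%N.
Proof. by case: o. Qed.

(** The letters of a code fill the whole time [n], so the code determines the full [P]-name, and the
    parts have diameter below [e]. *)
Lemma bcode_close c n x y (e : R) : (forall i p q, P i p -> P i q -> mdist p q < e) ->
  is_code T bitems blen bset c n x -> is_code T bitems blen bset c n y ->
  bowen T n x e y.
Proof.
move=> sm; elim: c n x y => [|o c IH] n x y /=; first by move=> -> _ [].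
move=> [_ lo xo cx] [_ _ yo cy] i ilt.
have [io|oi] := ltnP i (blen o); last first.
  have := IH _ _ _ cx cy (i - blen o)%N; rewrite -!iterD subnK//; apply.
  by rewrite ltn_sub2r// (leq_ltn_trans oi).
case: o {lo cx cy} xo yo io => [w|a] /= xo yo io.
  exact: (sm (w (Ordinal io)) _ _ (xo (Ordinal io)) (yo (Ordinal io))).
by case: i io {ilt} => // _; exact: (sm a).
Qed.

Lemma binfo_bmeas : bmeas (binfo : BX -> R).
Proof.
apply: bmeas_sum => w; apply: bmeasZ; apply: bmeas_indic; exact: measurable_cyl.
Qed.

Lemma binfo_ge0 x : 0 <= binfo x.
Proof.
apply: sumr_ge0 => w _; rewrite mulr_ge0//.
by rewrite oppr_ge0 ln_le0// bcyl_le1.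
Qed.

Lemma binfoE w x : cyl w x -> binfo x = - ln (bcyl w).
Proof.
move=> wx; rewrite /binfo (bigD1 w)//= big1 => [|u uw].
  by rewrite addr0 indicE mem_set// mulr1.
rewrite indicE memNset ?mulr0// => ux.
by move/eqP : uw; apply; exact: (@cyl_inj _ BX T m P dP k u w x ux wx).
Qed.

(** Smoothing lowers a mass at most by the factor 4, hence the [ln 4]; after division by [k] it
    disappears for long blocks. *)
Lemma int_binfo : \int[mu]_x binfo x <= @entropy _ BX R mu T m P k + ln 4.
Proof.
have mc (w : W) : measurable (cyl w : set BX) by exact: measurable_cyl.
rewrite /binfo int_sum => [|w]; last by apply: bmeasZ; exact: bmeas_indic.
have -> : ln 4 = \sum_w pr (cyl w) * ln 4 by rewrite -mulr_suml sum_pr_cyl1 ?mul1r.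
rewrite /entropy -big_split/=; apply: ler_sum => w _.
rewrite int_Z; last exact: bmeas_indic.
rewrite int_indic// phiEE.
have p0 := pr_ge0 mu (cyl w).
have [->|pn] := eqVneq (pr (cyl w)) 0; first by rewrite !mul0r mulr0 oppr0 addr0.
have pp : 0 < pr (cyl w) by rewrite lt_neqAle eq_sym pn.
have : ln (pr (cyl w) / 4) <= ln (bcyl w).
  rewrite ler_ln ?posrE ?bcyl_gt0 ?divr_gt0// /bcyl ler_wpM2r// lerDl invr_ge0.
  by rewrite exprn_ge0.
rewrite ln_div ?posrE// => h.
have := ler_wpM2l p0 h; lra.
Qed.

(** The averaging lemma, with the existence of a code of given cost as the relation: a block costs
    its information, a single symbol used to fill the ends costs [ln (2 * m)], and costs add under
    concatenation. *)
Lemma bcode_ex n x : (k <= n)%N -> exists2 c, is_code T bitems blen bset c n x &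
  - ln (cweight bwt c) <= k%:R^-1 * bsum T binfo n x + 2 * k%:R * ln (2 * m%:R).
Proof.
move=> kn.
have L0 : 0 <= ln (2 * m%:R : R) by rewrite ln_ge0// -natrM ler1n muln_gt0.
have cw0 c : 0 < cweight bwt c by apply: prodr_gt0 => *; exact: bwt_gt0.
have ib o : o \in bitems by rewrite mem_enum.
have := @subadd_avg R X T (fun n x r => exists2 c, is_code T bitems blen bset c n x &
  - ln (cweight bwt c) <= r) (ln (2 * m%:R)) 0 k binfo k0 L0 (lexx _).
rewrite mulr0 => h; have := h _ _ _ _ _ _ n x kn; rewrite addr0; apply => {h}.
- by move=> y; rewrite oppr0; exact: binfo_ge0.
- by move=> y; exists [::] => //; rewrite /cweight big_nil ln1 oppr0.
- move=> y; have [a ya] := cP y; exists [:: inr a]; first by split.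
  by rewrite /cweight big_seq1/= lnV ?opprK// posrE mulr_gt0.
- move=> y; have [w wy] := @cyl_ex _ BX T m P cP k y; exists [:: inl w].
    by split => //=; rewrite subnn.
  by rewrite /cweight big_seq1/= (binfoE wy).
- move=> n1 n2 y a b [c hc ca] [d hd db]; exists (c ++ d); first exact: is_code_cat hd.
  by rewrite cweight_cat lnM ?posrE// opprD lerD.
- by move=> n1 y a b [c hc ca] ab; exists c => //; exact: le_trans ab.
Qed.

End block_codes.

(* The sum of the averaged potential and of the averaged block information is a
   single bounded function, whose Birkhoff sums are controlled uniformly in [n]
   on the sets [K C]. *)
Lemma Lambda_upper (Fs eta D1 eps : R) (j : nat) : 0 < eta -> (0 < j)%N ->
  \int[mu]_x f j x <= j%:R * (Fs + eta) -> 0 < eps ->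
  (forall n x, (j <= n)%N ->
    supB T f n x eps <= j%:R^-1 * bsum T (f j) n x + n%:R * eta + D1) ->
  (forall i p q, P i p -> P i q -> mdist p q < eps) ->
  exists K : nat -> set BX, exists D : R, exists N : nat,
  [/\ forall C, measurable (K C), nondecreasing_seq K, pr (\bigcup_C K C) = 1 &
    forall C n, (N <= n)%N -> (Lambda T f (K C) n eps <=
      (expR (n%:R * (@entropy_rate _ BX R mu T m P + Fs + 5 * eta) + C%:R + D))%:E)%E].
Proof.
move=> eta0 j0 jF eps0 he sm.
set h := entropy_rate _ _ _.
have [k [k0 hk]] : exists k, (0 < k)%N /\
    k%:R^-1 * (@entropy _ BX R mu T m P k + ln 4) <= h + eta.
  have := entropy_rate_cvg mT inv_mu mP dP cP; rewrite -/h => hc.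
  have /cvgrPdist_le/(_ _ (divr_gt0 eta0 (ltr0n R 2)))[N _ hN] := hc.
  pose k := maxn N.+1 (Num.truncn (ln 4 / (eta / 2))).+1.
  exists k; split; first by rewrite /k leq_max.
  have Nk : (N <= k)%N by rewrite /k leq_max leqnSn.
  have := hN k Nk; rewrite ler_norml => /andP[h1 _].
  have kR : (0 : R) < k%:R by rewrite ltr0n /k leq_max.
  have : k%:R^-1 * ln 4 <= eta / 2.
    rewrite ler_pdivrMl// -ler_pdivrMr ?divr_gt0//.
    rewrite (le_trans (ltW (truncnS_gt _)))// ler_nat /k leq_max leqnn orbT//.
  rewrite mulrDr; lra.
have kR : (0 : R) < k%:R by rewrite ltr0n.
have jR : (0 : R) < j%:R by rewrite ltr0n.
have bfj := potential_bmeas mu cX sub_f j0.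
have bin := binfo_bmeas k.
pose g (x : BX) : R := j%:R^-1 * f j x + k%:R^-1 * binfo k x.
have bg : bmeas g by apply: bmeasD; exact: bmeasZ.
pose A := h + Fs + 3 * eta.
have ig : \int[mu]_x g x <= h + Fs + 2 * eta.
  rewrite /g int_D; try exact: bmeasZ.
  rewrite !int_Z//.
  have : j%:R^-1 * \int[mu]_x f j x <= Fs + eta by rewrite ler_pdivrMl.
  have : k%:R^-1 * \int[mu]_x binfo k x <= h + eta.
    by apply: le_trans hk; rewrite ler_pM2l ?invr_gt0//; exact: int_binfo.
  lra.
(* [A] exceeds the integral of [g] by at least [eta], which gives the strict negativity required by
   the maximal argument. *)
pose g' (x : BX) : R := g x + - A.
have bg' : bmeas g' by apply: bmeasD => //; exact: bmeas_cst.
have ig' : \int[mu]_x g' x < 0.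
  rewrite /g' int_D//; last exact: bmeas_cst.
  by rewrite int_cst /A; lra.
have h1 := ergodic_bsum_bounded mT inv_mu erg_mu.2 bg' ig'.
pose D2 := 2 * k%:R * ln (2 * m%:R) : R.
pose K := @bsum_below _ BX R T g'.
exists K, (D1 + D2), (maxn j k); split => //.
- by move=> C; exact: measurable_bsum_below.
- exact: bsum_below_homo.
move=> C n; rewrite geq_max => /andP[jn kn].
have bsumg x : bsum T g' n x = j%:R^-1 * bsum T (f j) n x +
    k%:R^-1 * bsum T (binfo k) n x - n%:R * A.
  rewrite /bsum /g' big_split/= sumr_const card_ord -[_ *+ n]mulr_natl mulrN.
  by rewrite /g big_split/= !mulr_sumr.
have n0 : (0 < n)%N by exact: leq_trans jn.
pose cs := codes (bitems k) (@blen k) n n.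
(* The points that use [c] economically. Nonempty [D c] supply the centres of the balls: all points
   with code [c] lie in the Bowen ball of any one of them. For empty [D c] the centre is
   irrelevant. *)
pose D (c : seq ({ffun 'I_k -> 'I_m} + 'I_m)) : set X := [set x |
  [/\ K C x, is_code T (bitems k) (@blen k) (@bset k) c n x &
   - ln (cweight (@bwt k) c) <= k%:R^-1 * bsum T (binfo k) n x + D2]].
pose cs' := [seq c <- cs | `[< D c !=set0 >]].
have ctr c : {x : X | D c !=set0 -> D c x}.
  by apply: cid; have [[x Dx]|nD] := pselect (D c !=set0); [exists x|exists x0].
pose ct c := projT1 (ctr c).
have ctP c : c \in cs' -> D c (ct c).
  by rewrite mem_filter => /andP[/asboolP nD _]; exact: (projT2 (ctr c)).
have cw0 c : 0 < cweight (@bwt k) c by apply: prodr_gt0 => *; exact: bwt_gt0.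
apply: (@le_trans _ _ (\esum_(i in `I_(size cs'))
    (expR (supB T f n (ct (nth [::] cs' i)) eps))%:E)%E).
  apply: ereal_inf_lbound; exists `I_(size cs'), (fun i => ct (nth [::] cs' i)).
  split => // y yK.
  have [c hc cc] := bcode_ex k0 y kn.
  have Dy : D c y by split.
  have ccs : c \in cs'.
    rewrite mem_filter; apply/andP; split; first by apply/asboolP; exists y.
    by apply: is_code_mem hc _ => // o; exact: blen_gt0.
  exists (index c cs'); rewrite /= ?index_mem// nth_index//.
  have [_ hcc _] := ctP _ ccs.
  exact: bcode_close sm hcc hc.
rewrite esum_fset// -fsbig_ord sumEFin lee_fin.
have -> : \sum_(i < size cs') expR (supB T f n (ct (nth [::] cs' i)) eps) =
    \sum_(c <- cs') expR (supB T f n (ct c) eps).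
  by rewrite (big_nth [::]) big_mkord.
set z := expR _.
(* On [K C] the averaged potential is at most [n A + C] minus the averaged information, and the
   information dominates [- ln] of the code weight up to [D2]. So each term is at most the weight
   times the common factor [z], and Kraft's inequality finishes. *)
apply: (@le_trans _ _ (\sum_(c <- cs') cweight (@bwt k) c * z)).
  rewrite big_seq [leRHS]big_seq; apply: ler_sum => c /ctP[hb hc hw].
  rewrite -{1}[cweight _ c]lnK ?posrE// /z -expRD ler_expR.
  have := he n (ct c) jn.
  have : 0 <= n%:R * eta by rewrite mulr_ge0// ltW.
  have := hb n; rewrite bsumg /A; lra.
rewrite -mulr_suml ler_piMl ?expR_ge0// /cs' big_filter.
have bw0 o : o \in bitems k -> 0 <= bwt o by move=> _; exact/ltW/bwt_gt0.
apply: le_trans (kraft (@blen k) bw0 (bwt_sum k) n n).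
rewrite [leRHS](bigID (fun c => `[< D c !=set0 >]))/= lerDl sumr_ge0// => c _.
exact: ltW.
Qed.

End one_partition.
End upper_bounds.

(** * The variational equalities *)

Section extended_sums.
Context {R : realType}.
Local Open Scope ereal_scope.

Lemma esum_subset (I : choiceType) (A B : set I) (a : I -> \bar R) : A `<=` B ->
  \esum_(i in A) a i <= \esum_(i in B) a i.
Proof.
move=> AB; apply: ge_ereal_sup => _ [F [finF FA] <-].
by apply: ereal_sup_ubound; exists F => //; split => //; exact: subset_trans AB.
Qed.

(** Covers are indexed families and may repeat a centre, while spanning sets are sets. Keeping the
    least index of each centre makes the indexing injective. *)
Lemma esum_image_le (I : choiceType) (J : set nat) (x : nat -> I) (a : I -> \bar R) :
  \esum_(y in x @` J) a y <= \esum_(i in J) a (x i).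
Proof.
pose J' : set nat := [set j | J j /\ forall i, J i -> x i = x j -> (j <= i)%N].
have -> : x @` J = x @` J'.
  apply/seteqP; split => [_ [j Jj <-]|_ [j [Jj _] <-]]; last by exists j.
  have ex : exists i, `[< J i /\ x i = x j >] by exists j; exact/asboolP.
  case: (ex_minnP ex) => i /asboolP[Ji xi] hi; exists i => //; split => // k Jk xk.
  by apply: hi; apply/asboolP; split => //; rewrite xk.
rewrite esum_image; first by apply: esum_subset => j [].
move=> i j /set_mem[Ji hi] /set_mem[Jj hj] xij.
by apply/eqP; rewrite eqn_leq hi//= hj.
Qed.

End extended_sums.

Section monotone_limits.
Context {R : realType}.
Local Open Scope ereal_scope.

Lemma le_limn_esup (u v : (\bar R)^nat) : (forall n, u n <= v n) ->
  limn_esup u <= limn_esup v.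
Proof.
move=> uv; apply: le_ereal_inf_tmp => _ [V V0 <-].
apply: (@le_trans _ _ (ereal_sup [set u x | x in V])).
  by apply: ereal_inf_lbound; exists V.
apply: ge_ereal_sup => _ [x Vx <-]; apply: (le_trans (uv x)).
by apply: ereal_sup_ubound; exists x.
Qed.

Lemma le_limf_einf (f g : R -> \bar R) : (forall x, f x <= g x) ->
  limf_einf f 0^'+ <= limf_einf g 0^'+.
Proof.
move=> fg; rewrite !limf_einfE; apply: ge_ereal_sup => _ [V V0 <-].
apply: (@le_trans _ _ (ereal_inf [set g x | x in V])).
  apply: le_ereal_inf_tmp => _ [x Vx <-]; apply: le_trans (fg x).
  by apply: ereal_inf_lbound; exists x.
by apply: ereal_sup_ubound; exists V.
Qed.

End monotone_limits.

(** * Elementary properties of the outer sums *)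

Section caratheodory.
Context {R : realType} {X : metricType R}.
Variables (T : X -> X) (f : nat -> X -> R).
Local Open Scope ereal_scope.

Lemma caraM_ge0 Z s N eps : 0 <= caraM T f Z s N eps.
Proof.
apply: le_ereal_inf_tmp => _ [J [x [n [_ _ ->]]]].
by apply: esum_ge0 => i _; rewrite lee_fin expR_ge0.
Qed.

Lemma caraM_homo Z s eps : nondecreasing_seq (fun N => caraM T f Z s N eps).
Proof.
move=> N M NM; apply: ereal_inf_le_tmp => _ [J [x [n [nM ZJ ->]]]].
by exists J, x, n; split => // i Ji; rewrite (leq_trans NM)// nM.
Qed.

Lemma caraM_le_caram Z s N eps : caraM T f Z s N eps <= caram T f Z s eps.
Proof.
have h := ereal_nondecreasing_cvgn (caraM_homo Z s eps).
rewrite /caram (cvg_lim _ h)//; apply: ereal_sup_ubound; by exists N.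
Qed.

Lemma caram_eq0 Z s eps : (forall N, caraM T f Z s N eps = 0) ->
  caram T f Z s eps = 0.
Proof.
move=> h; rewrite /caram (_ : (fun _ => _) = cst 0); first exact: lim_cst.
by apply/funext => N; rewrite h.
Qed.

Lemma caraM_Lambda Z s N n eps : (N <= n)%N ->
  caraM T f Z s N eps <= (expR (- (s * n%:R)))%:E * Lambda T f Z n eps.
Proof.
move=> Nn; have e0 := expR_gt0 (- (s * n%:R)).
rewrite -lee_pdivrMl//; apply: le_ereal_inf_tmp => _ [J [x [ZJ ->]]].
rewrite lee_pdivrMl//.
apply: (@le_trans _ _ (\esum_(i in J) (expR (- (s * n%:R) + supB T f n (x i) eps))%:E)).
  by apply: ereal_inf_lbound; exists J, x, (fun=> n).
apply: ge_ereal_sup => _ [F [finF FJ] <-].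
apply: (@le_trans _ _ ((expR (- (s * n%:R)))%:E * \sum_(i \in F) (expR (supB T f n (x i) eps))%:E)).
  rewrite !fsbig_finite//= !sumEFin -EFinM lee_fin mulr_sumr.
  by apply: ler_sum => i _; rewrite expRD.
apply: lee_wpmul2l; first by rewrite lee_fin ltW.
by apply: ereal_sup_ubound; exists F.
Qed.

(** Countable subadditivity: the [C]-th set receives a cover of sum at most [r / 2^(C+1)]. *)
Lemma caraM_bigcup_eq0 (Z : nat -> set X) s N eps :
  (forall C, caraM T f (Z C) s N eps = 0) ->
  caraM T f (\bigcup_C Z C) s N eps = 0.
Proof.
move=> h; apply/eqP; rewrite eq_le caraM_ge0 andbT; apply/lee_addgt0Pr => r r0.
rewrite add0e.
have hC (C : nat) : {c : set nat * (nat -> X) * (nat -> nat) |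
    [/\ forall i, c.1.1 i -> (N <= c.2 i)%N,
      Z C `<=` \bigcup_(i in c.1.1) bowen T (c.2 i) (c.1.2 i) eps &
      \esum_(i in c.1.1) (expR (- (s * (c.2 i)%:R) + supB T f (c.2 i) (c.1.2 i) eps))%:E
        <= (r / (2 ^ C.+1)%:R)%:E]}.
  apply: cid.
  have : caraM T f (Z C) s N eps < (r / (2 ^ C.+1)%:R)%:E.
    by rewrite h lte_fin divr_gt0// ltr0n expn_gt0.
  move=> /ereal_inf_lt[_ [J [x [n [nN ZJ ->]]]] lt].
  by exists (J, x, n); split => //; exact: ltW.
pose J C := (projT1 (hC C)).1.1; pose x C := (projT1 (hC C)).1.2.
pose n C := (projT1 (hC C)).2.
have hJ C : [/\ forall i, J C i -> (N <= n C i)%N,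
      Z C `<=` \bigcup_(i in J C) bowen T (n C i) (x C i) eps &
      \esum_(i in J C) (expR (- (s * (n C i)%:R) + supB T f (n C i) (x C i) eps))%:E
        <= (r / (2 ^ C.+1)%:R)%:E] := projT2 (hC C).
(* The covers are merged into one family indexed by natural numbers through an encoding of pairs;
   indices outside its image decode to a default pair and are excluded from the index set. *)
pose dec (i : nat) : nat * nat := odflt (0, 0)%N (choice.unpickle i).
have decK (p : nat * nat) : dec (choice.pickle p) = p by rewrite /dec choice.pickleK.
pose D : set (nat * nat) := [set: nat] `*`` J.
pose w (p : nat * nat) : \bar R :=
  (expR (- (s * (n p.1 p.2)%:R) + supB T f (n p.1 p.2) (x p.1 p.2) eps))%:E.
apply: (@le_trans _ _ (\esum_(i in choice.pickle @` D) w (dec i))).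
  apply: ereal_inf_lbound.
  exists (choice.pickle @` D), (fun i => x (dec i).1 (dec i).2), (fun i => n (dec i).1 (dec i).2).
  split => //.
    by move=> _ [p [_ Jp] <-]; rewrite decK; have [hn _ _] := hJ p.1; exact: hn.
  move=> y [C _ Cy]; have [_ /(_ _ Cy)[i Ji yi] _] := hJ C.
  by exists (choice.pickle (C, i)); [exists (C, i)|rewrite decK].
rewrite esum_image; last by move=> p q _ _; exact: (pcan_inj choice.pickleK).
under eq_esum do rewrite decK.
rewrite -(esum_esum (a := fun C i => w (C, i))); last first.
  by move=> C i _ _; rewrite lee_fin expR_ge0.
rewrite -nneseries_esumT; last first.
  by move=> C; apply: esum_ge0 => i _; rewrite lee_fin expR_ge0.
apply: le_trans (epsilon_trick0 xpredT (ltW r0)).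
apply: lee_nneseries => C _.
  by move=> _; apply: esum_ge0 => i _; rewrite lee_fin expR_ge0.
by have [_ _] := hJ C.
Qed.

End caratheodory.

Section variational_principle.
Context {R : realType} {X : metricType R} {x0 : X}.
Local Notation BX := (@borelX R X x0).
Variables (T : X -> X) (f : nat -> X -> R) (mu : probability BX R).
Hypothesis cX : compact [set: X].
Hypothesis cT : continuous T.
Hypothesis sub_f : subadditive_potential T f.
Hypothesis erg_mu : ergodic mu T.
Hypothesis FsNy : Fstar mu f <> -oo%E.
Local Open Scope ereal_scope.

Local Notation pr := (pr mu).
Let mT : measurable_fun setT (T : BX -> BX) := continuous_meas cT.
Let inv_mu : invariant mu T := erg_mu.1.

Lemma integral_potential n : (0 < n)%N ->
  \int[mu]_x (f n x)%:E = (\int[mu]_x f n x)%R%:E.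
Proof.
move=> n0; rewrite /Rintegral fineK//; apply: integrable_fin_num => //.
exact: bmeas_int (potential_bmeas mu cX sub_f n0).
Qed.

Lemma Fstar_fin : Fstar mu f \is a fin_num.
Proof.
rewrite fin_numE; apply/andP; split; first exact/eqP.
apply/negP => /eqP Fy.
have : Fstar mu f <= (1%:R^-1)%:E * \int[mu]_x (f 1%N x)%:E.
  by apply: ereal_inf_lbound; exists 1%N.
by rewrite integral_potential// -EFinM Fy.
Qed.

Local Notation Fs := (fine (Fstar mu f)).

Lemma Fs_le n : (0 < n)%N -> (n%:R * Fs <= \int[mu]_x f n x)%R.
Proof.
move=> n0; rewrite -ler_pdivlMl ?ltr0n// -lee_fin fineK ?Fstar_fin//.
by apply: ereal_inf_lbound; exists n => //; rewrite integral_potential.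
Qed.

Lemma Fs_approx (eta : R) : (0 < eta)%R -> exists2 j, (0 < j)%N &
  (\int[mu]_x f j x <= j%:R * (Fs + eta))%R.
Proof.
move=> eta0; have : Fstar mu f < (Fs + eta)%:E.
  by rewrite -[ltLHS]fineK ?Fstar_fin// lte_fin ltrDl.
move=> /ereal_inf_lt[_ [j j0 <-]]; rewrite integral_potential// -EFinM lte_fin.
by move=> /ltW h; exists j => //; rewrite -ler_pdivrMl// ltr0n.
Qed.

Lemma measurable_bowen_cover n eps (F : set X) :
  measurable (\bigcup_(x in F) bowen T n x eps : set BX).
Proof. by apply: open_meas; apply: bigcup_open => x _; exact: open_bowen. Qed.

Lemma span_le_Lambda (Z : set X) n (eps delta : R) : measurable (Z : set BX) ->
  (1 - delta)%:E <= mu Z -> spanPn mu T f n eps delta <= Lambda T f Z n eps.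
Proof.
move=> mZ hZ; apply: le_ereal_inf_tmp => _ [J [x [ZJ ->]]].
apply: le_trans (esum_image_le J x (fun y => (expR (supB T f n y eps))%:E)).
apply: ereal_inf_lbound; exists (x @` J) => //=.
apply: (le_trans hZ); apply: le_measure; try exact: mem_set.
  by apply: mem_set; exact: measurable_bowen_cover.
by move=> z /ZJ[i Ji zi]; exists (x i) => //; exists i.
Qed.

Lemma lne_homo (x y : \bar R) : 0 <= x -> x <= y -> lne x <= lne y.
Proof.
move=> x0' xy; rewrite lee_lne// in_itv/= leey andbT//.
exact: le_trans xy.
Qed.

Lemma spanPn_ge0 n eps delta : 0 <= spanPn mu T f n eps delta.
Proof.
apply: le_ereal_inf_tmp => _ [F _ <-].
by apply: esum_ge0 => i _; rewrite lee_fin expR_ge0.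
Qed.

Lemma log_rate_homo n (x y : \bar R) : 0 <= x -> x <= y ->
  (n%:R^-1)%:E * lne x <= (n%:R^-1)%:E * lne y.
Proof.
by move=> x1 xy; apply: lee_wpmul2l; [rewrite lee_fin invr_ge0|exact: lne_homo].
Qed.

Lemma spanPn_homo n eps (a b : R) : (a <= b)%R ->
  spanPn mu T f n eps b <= spanPn mu T f n eps a.
Proof.
move=> ab; apply: ereal_inf_le_tmp => _ [F hF <-]; exists F => //=.
by apply: le_trans hF; rewrite lee_fin; lra.
Qed.

Lemma spanP_delta_homo (a b : R) : (0 < a)%R -> (a <= b)%R ->
  spanP_delta mu T f b <= spanP_delta mu T f a.
Proof.
move=> _ ab; apply: le_limf_einf => eps; apply: le_limn_esup => n.
by apply: log_rate_homo; [exact: spanPn_ge0|exact: spanPn_homo].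
Qed.

Lemma inf_measure_homo (u : set X -> \bar R) (a b : R) : (0 < a)%R -> (a <= b)%R ->
  ereal_inf [set u Z | Z in [set Z : set X | measurable (Z : set BX) /\ (1 - b)%:E <= mu Z]]
  <= ereal_inf [set u Z | Z in [set Z : set X | measurable (Z : set BX) /\ (1 - a)%:E <= mu Z]].
Proof.
move=> _ ab; apply: ereal_inf_le_tmp => _ [Z [mZ hZ] <-]; exists Z => //; split => //.
by apply: le_trans hZ; rewrite lee_fin; lra.
Qed.

Lemma variational_lower (Q : \bar R) :
  (forall m (P : 'I_m -> set X), @fin_partition R X x0 m P ->
    forall eta : R, (0 < eta)%R ->
    (@entropy_rate _ BX R mu T m P + Fs - eta)%:E <= Q) ->
  ks_entropy mu T + Fstar mu f <= Q.
Proof.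
move=> h; rewrite -leeBrDr ?Fstar_fin//; apply: ge_ereal_sup => _ [[m P] hP <-].
rewrite leeBrDr ?Fstar_fin//; apply/lee_addgt0Pr => e e0.
move: (h m P hP e e0).
by rewrite EFinB leeBlDr// EFinD fineK ?Fstar_fin.
Qed.

Lemma span_rate_lower m (P : 'I_m -> set X) (eta : R) : @fin_partition R X x0 m P ->
  (0 < eta)%R -> exists t e : R, exists N : nat,
  [/\ (0 < t)%R, (0 < e)%R & forall n (eps delta : R), (N <= n)%N -> (0 < eps)%R ->
    (eps < e)%R -> (delta <= t)%R ->
    (@entropy_rate _ BX R mu T m P + Fs - eta)%:E <=
      (n%:R^-1)%:E * lne (spanPn mu T f n eps delta)].
Proof.
move=> [mP [dP cP]] eta0; have eta20 : (0 < eta / 2)%R by rewrite divr_gt0.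
have [t [e [t0 e0 h]]] := span_lower cX cT sub_f inv_mu Fs_le mP dP cP eta20.
(* From this time on the constant 4 is at most [n * eta / 2]; the other half of [eta] was spent in
   [span_lower]. *)
exists t, e, (Num.truncn (4 / (eta / 2))).+1; split => // n eps delta Nn eps0 epse dt.
have n0 : (0 < n)%N by exact: leq_trans Nn.
have nR : (0 < n%:R :> R)%R by rewrite ltr0n.
set a := (_ - eta)%R.
have -> : a%:E = (n%:R^-1)%:E * (n%:R * a)%:E.
  by rewrite -EFinM mulKf ?gt_eqF.
apply: lee_wpmul2l; first by rewrite lee_fin invr_ge0.
apply: le_trans (h n eps delta n0 eps0 epse dt); rewrite lee_fin.
have h1 := Fs_le n0.
have h2 := entropy_rate_le mT inv_mu mP dP cP n0.
have h3 : (n%:R * @entropy_rate _ BX R mu T m P <= @entropy _ BX R mu T m P n)%R.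
  by rewrite -ler_pdivlMl.
have h4 : (4 <= n%:R * (eta / 2))%R.
  rewrite -ler_pdivrMr// (le_trans (ltW (truncnS_gt _)))// ler_nat//.
rewrite /a; lra.
Qed.

Lemma spanP_lower : ks_entropy mu T + Fstar mu f <= spanP mu T f.
Proof.
apply: variational_lower => m P hP eta eta0.
have [t [e [N [t0 e0 h]]]] := span_rate_lower hP eta0.
apply: (monotone_right_ge spanP_delta_homo t0) => delta d0 dt.
apply: (limf_einf_ge e0) => eps eps0 epse.
apply: le_trans (limn_einf_sup _); apply: (limn_einf_ge (N := N)) => n Nn.
by apply: h => //; exact: ltW.
Qed.

Lemma lowCPstar_lower : ks_entropy mu T + Fstar mu f <= lowCPstar mu T f.
Proof.
apply: variational_lower => m P hP eta eta0.
have [t [e [N [t0 e0 h]]]] := span_rate_lower hP eta0.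
apply: (limf_einf_ge e0) => eps eps0 epse.
apply: (monotone_right_ge (@inf_measure_homo _) t0) => delta d0 dt.
apply: le_ereal_inf_tmp => _ [Z [mZ hZ] <-].
apply: (limn_einf_ge (N := N)) => n Nn.
apply: le_trans (h n eps delta Nn eps0 epse (ltW dt)) _.
by apply: log_rate_homo; [exact: spanPn_ge0|exact: span_le_Lambda].
Qed.

Lemma Pstar_lower : ks_entropy mu T + Fstar mu f <= Pstar mu T f.
Proof.
apply: variational_lower => m P [mP [dP cP]] eta eta0.
have [e e0 h] := cara_lower cX cT sub_f inv_mu Fs_le mP dP cP eta0.
apply: (limf_einf_ge e0) => eps eps0 epse.
apply: le_ereal_inf_tmp => _ [Z [mZ Z1] <-].
apply: le_ereal_inf_tmp => _ [s sZ <-]; rewrite lee_fin.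
suff : (@entropy_rate _ BX R mu T m P + Fs <= s + eta)%R by lra.
apply: (h Z eps s mZ Z1 eps0 epse).
apply: le_lt_trans (caraM_le_caram T f Z s 1 eps) _.
by rewrite sZ lte_fin divr_gt0.
Qed.

(** The partition, and with it [a], [K] and [D], depends on [eps]. What is uniform is the bound on
    [a], since the entropy rate of any finite partition is at most the supremum. *)
Lemma good_sets (eta : R) : (0 < eta)%R -> exists2 e : R, (0 < e)%R &
  forall eps : R, (0 < eps)%R -> (eps < e)%R ->
  exists a : R, exists K : nat -> set BX, exists D : R, exists N : nat,
  [/\ a%:E <= ks_entropy mu T + Fstar mu f + eta%:E,
    (forall C, measurable (K C)) /\ nondecreasing_seq K, pr (\bigcup_C K C) = 1%R &
    forall C n, (N <= n)%N ->
      Lambda T f (K C) n eps <= (expR (n%:R * a + C%:R + D))%:E].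
Proof.
(* The exponent in [Lambda_upper] loses [5 * eta]. *)
move=> eta0; have e50 : (0 < eta / 5)%R by rewrite divr_gt0.
have [j j0 jF] := Fs_approx e50.
have [D1 [e e0 he]] := supB_avg mu cX sub_f j0 e50.
exists e => // eps eps0 epse.
have [m [P [hP sm]]] := @small_partition R X x0 cX eps eps0.
have [mP [dP cP]] := hP.
have he' n x : (j <= n)%N -> (supB T f n x eps <=
    j%:R^-1 * bsum T (f j) n x + n%:R * (eta / 5) + D1)%R.
  by move=> jn; exact: he.
have [K [D [N [mK ndK K1 hK]]]] :=
  Lambda_upper cX cT sub_f erg_mu mP dP cP e50 j0 jF eps0 he' sm.
exists (@entropy_rate _ BX R mu T m P + Fs + 5 * (eta / 5))%R, K, D, N; split => //.
rewrite (_ : 5 * (eta / 5) = eta)%R; last by field.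
rewrite !EFinD fineK ?Fstar_fin// leeD2r// leeD2r//.
by apply: ereal_sup_ubound; exists (existT _ m P).
Qed.

Lemma good_set_large (K : nat -> set BX) (delta : R) :
  (forall C, measurable (K C)) -> nondecreasing_seq K -> pr (\bigcup_C K C) = 1%R ->
  (0 < delta)%R -> exists C, (1 - delta)%:E <= mu (K C).
Proof.
move=> mK ndK K1 d0; have [C] := pr_bigcup_approx mu mK ndK d0.
by rewrite K1 => h; exists C; rewrite -prE// lee_fin.
Qed.

Lemma log_rate_upper (a c eta : R) : (0 < eta)%R -> exists N, forall n (x : \bar R),
  (N <= n)%N -> 0 <= x -> x <= (expR (n%:R * a + c))%:E ->
  (n%:R^-1)%:E * lne x <= (a + eta)%:E.
Proof.
move=> eta0; exists (Num.truncn (`|c| / eta)).+1 => n x Nn x1 xe.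
have n0 : (0 < n)%N by exact: leq_trans Nn.
have nR : (0 < n%:R :> R)%R by rewrite ltr0n.
apply: le_trans (log_rate_homo n x1 xe) _.
rewrite lne_EFin ?expR_gt0// expRK -EFinM lee_fin mulrDr mulKf ?gt_eqF// lerD2l.
rewrite ler_pdivrMl// (le_trans (ler_norm c))// -ler_pdivrMr//.
by rewrite (le_trans (ltW (truncnS_gt _)))// ler_nat.
Qed.

Lemma Lambda_ge0 Z n eps : 0 <= Lambda T f Z n eps.
Proof.
apply: le_ereal_inf_tmp => _ [J [x [_ ->]]].
by apply: esum_ge0 => i _; rewrite lee_fin expR_ge0.
Qed.

Lemma upCPstar_upper : upCPstar mu T f <= ks_entropy mu T + Fstar mu f.
Proof.
apply/lee_addgt0Pr => eta eta0; have e20 : (0 < eta / 2)%R by rewrite divr_gt0.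
have [e e0 h] := good_sets e20.
apply: (limf_einf_le e0) => eps eps0 epse.
have [a [K [D [N [ha [mK ndK] K1 hK]]]]] := h eps eps0 epse.
apply: (monotone_right_le (@inf_measure_homo _) ltr01) => delta d0 _.
have [C hC] := good_set_large mK ndK K1 d0.
apply: (@le_trans _ _ (upCPZ T f (K C) eps)); first by apply: ereal_inf_lbound; exists (K C).
have -> : eta = (eta / 2 + eta / 2)%R by field.
rewrite EFinD addeA; apply: le_trans (leeD2r _ ha); rewrite -EFinD.
have [N' hN'] := log_rate_upper a (C%:R + D)%R e20.
apply: (limn_esup_le (N := maxn N N')) => n; rewrite geq_max => /andP[Nn N'n].
apply: hN' => //; first exact: Lambda_ge0.
by rewrite addrA; exact: hK.
Qed.

Lemma spanP_upper : spanP mu T f <= ks_entropy mu T + Fstar mu f.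
Proof.
apply/lee_addgt0Pr => eta eta0; have e20 : (0 < eta / 2)%R by rewrite divr_gt0.
have [e e0 h] := good_sets e20.
apply: (monotone_right_le spanP_delta_homo ltr01) => delta d0 _.
apply: (limf_einf_le e0) => eps eps0 epse.
have [a [K [D [N [ha [mK ndK] K1 hK]]]]] := h eps eps0 epse.
have [C hC] := good_set_large mK ndK K1 d0.
have -> : eta = (eta / 2 + eta / 2)%R by field.
rewrite EFinD addeA; apply: le_trans (leeD2r _ ha); rewrite -EFinD.
have [N' hN'] := log_rate_upper a (C%:R + D)%R e20.
apply: (limn_esup_le (N := maxn N N')) => n; rewrite geq_max => /andP[Nn N'n].
apply: hN' => //; first exact: spanPn_ge0.
apply: (le_trans (span_le_Lambda n eps (mK C) hC)).
by rewrite addrA; exact: hK.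
Qed.

(** The union of the [K C] has full measure. Slightly above the exponent [a], covers of a single
    large length already make the outer sum of each [K C] arbitrarily small, and null outer sums
    pass to the union. *)
Lemma Pstar_upper : Pstar mu T f <= ks_entropy mu T + Fstar mu f.
Proof.
apply/lee_addgt0Pr => eta eta0; have e20 : (0 < eta / 2)%R by rewrite divr_gt0.
have [e e0 h] := good_sets e20.
apply: (limf_einf_le e0) => eps eps0 epse.
have [a [K [D [N [ha [mK ndK] K1 hK]]]]] := h eps eps0 epse.
have mKK : measurable (\bigcup_C K C) by exact: bigcup_measurable.
apply: (@le_trans _ _ (caraPZ_eps T f (\bigcup_C K C) eps)).
  by apply: ereal_inf_lbound; exists (\bigcup_C K C) => //; split; rewrite // -prE// K1.
have -> : eta = (eta / 2 + eta / 2)%R by field.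
rewrite EFinD addeA; apply: le_trans (leeD2r _ ha); rewrite -EFinD.
apply: ereal_inf_lbound; exists (a + eta / 2)%R => //=.
apply: caram_eq0 => M; apply: caraM_bigcup_eq0 => C.
apply/eqP; rewrite eq_le caraM_ge0 andbT; apply/lee_addgt0Pr => r r0; rewrite add0e.
(* The gain [n * eta / 2] in the exponent must absorb [C + D] and reach down to [ln r]. *)
pose n := maxn (maxn M N) (Num.truncn (`|C%:R + D - ln r| / (eta / 2))%R).+1.
have nM : (M <= n)%N by rewrite /n !leq_max leqnn.
have nN : (N <= n)%N by rewrite /n !leq_max leqnn orbT.
have nr : (`|C%:R + D - ln r| <= n%:R * (eta / 2))%R.
  rewrite -ler_pdivrMr// (le_trans (ltW (truncnS_gt _)))// ler_nat.
  by rewrite /n leq_max leqnn orbT.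
apply: (le_trans (caraM_Lambda T f (K C) (a + eta / 2) eps nM)).
apply: (@le_trans _ _ ((expR (- ((a + eta / 2) * n%:R)))%:E *
    (expR (n%:R * a + C%:R + D))%:E)).
  by apply: lee_wpmul2l; [rewrite lee_fin expR_ge0|exact: hK].
rewrite -EFinM -expRD lee_fin -[leRHS]lnK ?posrE// ler_expR.
have := le_trans (ler_norm _) nr; lra.
Qed.

Lemma lowCPstar_le_upCPstar : lowCPstar mu T f <= upCPstar mu T f.
Proof.
apply: le_limf_einf => eps.
apply: lee_lim; [exact: monotone_right_cvg (@inf_measure_homo _)
                |exact: monotone_right_cvg (@inf_measure_homo _)|].
apply: nearW => delta; apply: le_ereal_inf_tmp => _ [Z hZ <-].
apply: (@le_trans _ _ (lowCPZ T f Z eps)); last exact: limn_einf_sup.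
by apply: ereal_inf_lbound; exists Z.
Qed.

End variational_principle.

Theorem theoremA (R : realType) (X : metricType R) (x0 : X)
  (T : X -> X) (f : nat -> X -> R) (mu : probability (borelX x0) R) :
  compact [set: X] ->
  continuous T ->
  subadditive_potential T f ->
  ergodic mu T ->
  Fstar mu f <> -oo%E ->
  Pstar mu T f = lowCPstar mu T f /\
  lowCPstar mu T f = upCPstar mu T f /\
  upCPstar mu T f = spanP mu T f /\
  spanP mu T f = (ks_entropy mu T + Fstar mu f)%E.
Proof.
move=> cX cT sub_f erg_mu FsNy.
(* Links the two capacity pressures: the lower bound is proved for the smaller one and the upper
   bound for the larger one. *)
have lu := lowCPstar_le_upCPstar T f mu.
have lo := lowCPstar_lower cX cT sub_f erg_mu FsNy.
have up := upCPstar_upper cX cT sub_f erg_mu FsNy.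
have -> : Pstar mu T f = (ks_entropy mu T + Fstar mu f)%E.
  by apply/le_anti; rewrite Pstar_upper// Pstar_lower.
have -> : spanP mu T f = (ks_entropy mu T + Fstar mu f)%E.
  by apply/le_anti; rewrite spanP_upper// spanP_lower.
have -> : lowCPstar mu T f = (ks_entropy mu T + Fstar mu f)%E.
  by apply/le_anti; rewrite lo (le_trans lu).
have -> // : upCPstar mu T f = (ks_entropy mu T + Fstar mu f)%E.
by apply/le_anti; rewrite up (le_trans lo).
Qed.
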